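(* Let $\mathbf M$ and $\mathbf N$ be the monoid varieties $$\mathbf M=\operatorname{var}\{\Phi,\ xyzxy\approx yxzxy,\ \sigma_2\},\qquad \mathbf N=\operatorname{var}\{\Phi,\ \sigma_2\},$$ where $\Phi=\{x^2y\approx yx^2,\ x^2yz\approx xyxzx,\ \sigma_3\}$, $\sigma_2$ is the identity $xtyzxy\approx xtyzyx$ and $\sigma_3$ is the identity $xzxyty\approx xzyxty$. Let $\overleftarrow{\mathbf M}$ be the variety dual to $\mathbf M$. Then: (i) The variety $\mathbf N\vee\overleftarrow{\mathbf M}$ covers the variety $\mathbf N$ (in the lattice of all monoid varieties). (ii) The interval $[\mathbf M\vee\overleftarrow{\mathbf M},\ \mathbf N\vee\overleftarrow{\mathbf M}]$ of the subvariety lattice $L(\mathbf N\vee\overleftarrow{\mathbf M})$ contains continuum many varieties, and it satisfies neither the ascending chain condition nor the descending chain condition.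
   Context: Monoids are considered as algebras with an associative binary operation and a nullary operation fixing the identity element; a variety means a variety of monoids in this signature (so in an identity any letter may be replaced by the identity element). For an identity system $\Sigma$, $\operatorname{var}\Sigma$ denotes the variety of all monoids satisfying $\Sigma$; when $\Phi$ is listed inside the braces, all identities of $\Phi$ are included. For a monoid variety $\mathbf V$, $\overleftarrow{\mathbf V}$ (the variety dual to $\mathbf V$) is the variety of all monoids antiisomorphic to monoids from $\mathbf V$, and $L(\mathbf V)$ is the lattice of all subvarieties of $\mathbf V$ ordered by inclusion. The join $\mathbf U\vee\mathbf W$ is the smallest monoid variety containing both $\mathbf U$ and $\mathbf W$. A variety $\mathbf U$ covers $\mathbf W$ if $\mathbf W\subsetneq\mathbf U$ and there is no variety strictly between them. ''Continuum many'' means of cardinality $2^{\aleph_0}$. *)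

(* Defs.v *)
From HB Require Import structures.
From Stdlib Require Import FunctionalExtensionality PropExtensionality.
From mathcomp Require Import all_boot.

Set Implicit Arguments.
Unset Strict Implicit.
Unset Printing Implicit Defensive.

(* Words over the countable alphabet nat; [::] is the empty word, i.e. the
   identity element of the free monoid. *)
Definition word := seq nat.
Definition identity := (word * word)%type.

Definition eval (G : monoidType) (a : nat -> G) (w : word) : G :=
  (\prod_(i <- w) a i)%g.

(* Assignments may send letters to 1. *)
Definition satisfies (G : monoidType) (e : identity) : Prop :=
  forall a : nat -> G, eval a e.1 = eval a e.2.

Definition mclass := monoidType -> Prop.

Definition subclass (U V : mclass) : Prop := forall G, U G -> V G.

Definition proper_subclass (U V : mclass) : Prop := subclass U V /\ U <> V.

Definition var (S : identity -> Prop) : mclass :=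
  fun G => forall e, S e -> satisfies G e.

Definition is_variety (V : mclass) : Prop := exists S, V = var S.

Definition antiisomorphic (G H : monoidType) : Prop :=
  exists f : G -> H,
    [/\ bijective f, f 1%g = 1%g & {morph f : x y / (x * y)%g >-> (y * x)%g}].

Definition dual (V : mclass) : mclass :=
  fun G => exists2 H : monoidType, V H & antiisomorphic G H.

(* The intersection of all varieties containing U and W; it is a variety by
   join_variety below. *)
Definition join (U W : mclass) : mclass :=
  fun G => forall V, is_variety V -> subclass U V -> subclass W V -> V G.

Definition covers (U W : mclass) : Prop :=
  [/\ is_variety U, is_variety W, proper_subclass W U
    & ~ exists V,
        [/\ is_variety V, proper_subclass W V & proper_subclass V U]].

Definition subvarieties (W : mclass) : mclass -> Prop :=
  fun V => is_variety V /\ subclass V W.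

Definition interval (L : mclass -> Prop) (U W : mclass) : mclass -> Prop :=
  fun V => [/\ L V, subclass U V & subclass V W].

Definition continuum_many (P : mclass -> Prop) : Prop :=
  exists f : (nat -> bool) -> mclass,
    injective f /\ forall V, P V <-> exists b, f b = V.

Definition acc (P : mclass -> Prop) : Prop :=
  forall V : nat -> mclass,
    (forall n, P (V n)) -> (forall n, subclass (V n) (V n.+1)) ->
    exists n, forall m, n <= m -> V m = V n.

Definition dcc (P : mclass -> Prop) : Prop :=
  forall V : nat -> mclass,
    (forall n, P (V n)) -> (forall n, subclass (V n.+1) (V n)) ->
    exists n, forall m, n <= m -> V m = V n.

Local Notation x := 0 (only parsing).
Local Notation y := 1 (only parsing).
Local Notation z := 2 (only parsing).
Local Notation t := 3 (only parsing).

Definition sigma2 : identity := ([:: x; t; y; z; x; y], [:: x; t; y; z; y; x]).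

Definition sigma3 : identity := ([:: x; z; x; y; t; y], [:: x; z; y; x; t; y]).

Definition Phi : seq identity :=
  [:: ([:: x; x; y], [:: y; x; x]);
      ([:: x; x; y; z], [:: x; y; x; z; x]);
      sigma3].

Definition varM : mclass :=
  var (fun e =>
    e \in Phi ++ [:: ([:: x; y; z; x; y], [:: y; x; z; x; y]); sigma2]).

Definition varN : mclass := var (fun e => e \in Phi ++ [:: sigma2]).

Lemma mclass_ext (U V : mclass) : subclass U V -> subclass V U -> U = V.
Proof.
move=> UV VU; apply: functional_extensionality => G.
by apply: propositional_extensionality; split=> [/UV|/VU].
Qed.

Lemma var_variety S : is_variety (var S).
Proof. by exists S. Qed.

Lemma join_variety U W : is_variety (join U W).
Proof.
exists (fun e => forall G, U G \/ W G -> satisfies G e).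
apply: mclass_ext => G JG.
  apply: JG; first exact: var_variety.
    by move=> H UH e; apply; left.
  by move=> H WH e; apply; right.
move=> _ [S ->] US WS e Se; apply: JG => H [/US|/WS]; by apply.
Qed.

Lemma join_least U W : [/\ subclass U (join U W), subclass W (join U W)
  & forall V, is_variety V -> subclass U V -> subclass W V ->
      subclass (join U W) V].
Proof.
split; [by move=> G UG V _ UV _; apply: UV|by move=> G WG V _ _; apply|].
by move=> V Vv UV WV G; apply.
Qed.

Definition opposite (G : monoidType) : Type := G.
HB.instance Definition _ (G : monoidType) := Choice.on (opposite G).

Section Opposite.
Variable G : monoidType.
Definition op_mul (a b : opposite G) : opposite G := ((b : G) * (a : G))%g.
Definition op_one : opposite G := (1%g : G).
Lemma op_mulA : associative op_mul.
Proof. by move=> a b c; rewrite /op_mul mulgA. Qed.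
Lemma op_mul1 : left_id op_one op_mul.
Proof. by move=> a; apply: mulg1. Qed.
Lemma op_mulr1 : right_id op_one op_mul.
Proof. by move=> a; apply: mul1g. Qed.
HB.instance Definition _ :=
  isMonoid.Build (opposite G) op_mulA op_mul1 op_mulr1.
End Opposite.

Lemma eval_anti (G H : monoidType) (f : G -> H) (a : nat -> G) w :
  f 1%g = 1%g -> {morph f : u v / (u * v)%g >-> (v * u)%g} ->
  f (eval a w) = eval (f \o a) (rev w).
Proof.
move=> f1 fM; rewrite /eval; elim: w => [|i w IH]; first by rewrite !big_nil.
by rewrite big_cons fM IH rev_cons -cats1 big_cat big_seq1.
Qed.

Lemma dual_variety V : is_variety V -> is_variety (dual V).
Proof.
case=> S ->; exists (fun e => S (rev e.1, rev e.2)); apply: mclass_ext => G.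
  case=> H SH [f [fbij f1 fM]] e Se a; apply: (bij_inj fbij).
  by rewrite !eval_anti //; apply: (SH _ Se).
move=> SG; exists (opposite G : monoidType); last first.
  by exists (id : G -> opposite G); split=> //; exists id.
move=> [u v] Suv a.
have := SG (rev u, rev v); rewrite /= !revK => /(_ Suv a).
by rewrite /= -!(@eval_anti (opposite G) G id).
Qed.

(* Main.v *)
(* Varieties of monoids are handled through their fully invariant congruences on
   the free monoid over nat (Birkhoff's completeness theorem).

   Call a letter of a word core if it is simple (occurs once), or occurs twice
   with a simple letter in between.  Modulo the identities of N or of its dual,
   a letter x that is not core can be pulled out as a central factor x^2, and in
   the remaining word two adjacent occurrences of core letters can be swapped
   unless one of them is simple, or both are first occurrences (for N), or both
   are second occurrences of letters whose first occurrences are separated by a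
   simple letter (for the dual of M).  Hence an identity of N that fails in the
   dual of M exhibits such a separated pair and implies sigma2, after deletion
   of the other letters.  As N is the variety of the monoids of the join that
   satisfy sigma2, the join covers N.

   For (ii), take the words osc_l n = p x y t q x s y, where every letter of p
   and q is followed by a simple letter of its own and s is a permutation of the
   letters of p and q.  No other word is equal to osc_l n in both N and the dual
   of M.  The identity that swaps the factor xy of osc_l m can change osc_l n
   only if deleting letters of osc_l m yields osc_l n up to renaming, with x and
   y fixed.  The orders of p and s are chosen so that their inversion graph is a
   path of length growing with n, whose two ends are recognized by the two
   letters of q; this makes the family an antichain, so that the sets of
   identities swapping x and y in osc_l n define pairwise distinct varieties. *)

From HB Require Import structures.
From mathcomp Require Import all_boot zify.
From mathcomp Require Import boolp classical_sets functions cardinality.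
Require Import Defs.

Set Implicit Arguments.
Unset Strict Implicit.
Unset Printing Implicit Defensive.

(** * Equational logic *)

Definition subst (s : nat -> word) (w : word) : word := flatten (map s w).

Lemma subst_cat s u v : subst s (u ++ v) = subst s u ++ subst s v.
Proof. by rewrite /subst map_cat flatten_cat. Qed.

Lemma subst_subst r s w : subst r (subst s w) = subst (subst r \o s) w.
Proof.
elim: w => //= i w IH.
by rewrite -[subst s (i :: w)]/(s i ++ subst s w) subst_cat IH.
Qed.

(** Equational deduction for monoids: as [s] may send letters to the empty word, erasing letters in
    an identity of [S] is part of a step. *)
Inductive derives (S : identity -> Prop) : word -> word -> Prop :=
| derives_refl u : derives S u u
| derives_sym u v : derives S u v -> derives S v u
| derives_trans u v w : derives S u v -> derives S v w -> derives S u w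
| derives_step a b s e :
    S e -> derives S (a ++ subst s e.1 ++ b) (a ++ subst s e.2 ++ b).
Arguments derives_trans {S u} v {w}.

Lemma derives_ctx S a b u v :
  derives S u v -> derives S (a ++ u ++ b) (a ++ v ++ b).
Proof.
elim=> {u v} [u|u v _|u v w _ uv _|c d s e Se].
- exact: derives_refl.
- exact: derives_sym.
- exact: derives_trans.
have := derives_step (a ++ c) (d ++ b) s Se.
by rewrite -!catA.
Qed.

Lemma derives_cat S u v u' v' :
  derives S u v -> derives S u' v' -> derives S (u ++ u') (v ++ v').
Proof.
move=> uv uv'; apply: (derives_trans (v ++ u')).
  exact: (derives_ctx [::] u' uv).
by have := derives_ctx v [::] uv'; rewrite !cats0.
Qed.

Lemma derives_subst S r u v :
  derives S u v -> derives S (subst r u) (subst r v).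
Proof.
elim=> {u v} [u|u v _|u v w _ uv _|a b s e Se].
- exact: derives_refl.
- exact: derives_sym.
- exact: derives_trans.
by rewrite !subst_cat !subst_subst; apply: derives_step.
Qed.

Lemma eval_cat (G : monoidType) (a : nat -> G) u v :
  eval a (u ++ v) = (eval a u * eval a v)%g.
Proof. by rewrite /eval big_cat. Qed.

Lemma eval_subst (G : monoidType) (a : nat -> G) s w :
  eval a (subst s w) = eval (eval a \o s) w.
Proof.
elim: w => [|i w IH]; first by rewrite /eval !big_nil.
by rewrite -[subst s _]/(s i ++ subst s w) eval_cat IH /eval big_cons.
Qed.

Lemma derives_sound S (G : monoidType) u v :
  var S G -> derives S u v -> satisfies G (u, v).
Proof.
move=> SG; elim=> {u v} [u|u v _ uv|u v w _ uv _ vw|a b s e Se] f //=.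
  by rewrite (uv f) (vw f).
by rewrite !eval_cat !eval_subst; have -> := SG _ Se (eval f \o s).
Qed.

Section FreeMonoid.
Variable S : identity -> Prop.

Definition derivesb (u v : word) : bool := `[< derives S u v >].

Lemma derivesb_refl : reflexive derivesb.
Proof. by move=> u; apply/asboolP; apply: derives_refl. Qed.

Lemma derivesb_sym : symmetric derivesb.
Proof. by move=> u v; apply/asboolP/asboolP; apply: derives_sym. Qed.

Lemma derivesb_trans : transitive derivesb.
Proof.
by move=> v u w /asboolP uv /asboolP vw; apply/asboolP; apply: derives_trans vw.
Qed.

Canonical derivesb_equiv :=
  EquivRel derivesb derivesb_refl derivesb_sym derivesb_trans.

(** The relatively free monoid of [var S] on countably many generators. *)
Definition free_monoid := {eq_quot derivesb}%qT.
HB.instance Definition _ := Choice.on free_monoid.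

Definition class_of (w : word) : free_monoid := (\pi_({eq_quot derivesb}) w)%qT.

Lemma class_ofP u v : class_of u = class_of v <-> derives S u v.
Proof.
split=> [uv|uv]; first exact/asboolP/(eqmodP derivesb_equiv).
exact/(eqmodP derivesb_equiv)/asboolP.
Qed.

Lemma class_of_repr (g : free_monoid) : class_of (repr g) = g.
Proof. exact: reprK. Qed.

Definition free_mul (g h : free_monoid) : free_monoid :=
  class_of (repr g ++ repr h).

Lemma class_of_cat u v : class_of (u ++ v) = free_mul (class_of u) (class_of v).
Proof. by apply/class_ofP/derives_cat; apply/class_ofP;
  rewrite class_of_repr. Qed.

Lemma free_mulA : associative free_mul.
Proof.
move=> f g h; rewrite -(class_of_repr f) -(class_of_repr g) -(class_of_repr h).
by rewrite -!class_of_cat catA.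
Qed.

Lemma free_mul1g : left_id (class_of [::]) free_mul.
Proof. by move=> g; rewrite -(class_of_repr g) -class_of_cat. Qed.

Lemma free_mulg1 : right_id (class_of [::]) free_mul.
Proof. by move=> g; rewrite -(class_of_repr g) -class_of_cat cats0. Qed.

HB.instance Definition _ :=
  isMonoid.Build free_monoid free_mulA free_mul1g free_mulg1.

Lemma eval_class (s : nat -> word) w :
  eval (fun i => class_of (s i)) w = class_of (subst s w).
Proof.
elim: w => [|i w IH]; first by rewrite /eval big_nil.
rewrite -[subst s _]/(s i ++ subst s w) class_of_cat -IH.
by rewrite /eval big_cons.
Qed.

(** Choosing representatives turns an assignment into a substitution, so each identity of [S]
    becomes a single derivation step. *)
Lemma free_monoid_var : var S free_monoid.
Proof.
move=> e Se a; pose s i := repr (a i).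
have -> : a = fun i => class_of (s i).
  by apply: funext => i; rewrite class_of_repr.
rewrite !eval_class; apply/class_ofP.
by have := derives_step [::] [::] s Se; rewrite !cats0.
Qed.

End FreeMonoid.

Lemma subst_letters w : subst (fun i => [:: i]) w = w.
Proof. by elim: w => //= i w; rewrite /subst /= => ->. Qed.

(** Birkhoff's theorem: evaluate the identity in the relatively free monoid at its generators. *)
Lemma derives_complete S u v :
  (forall G, var S G -> satisfies G (u, v)) -> derives S u v.
Proof.
move=> /(_ _ (@free_monoid_var S)) /(_ (fun i => class_of S [:: i])) /=.
by rewrite !eval_class !subst_letters => /class_ofP.
Qed.

(** * Finite sets of words closed under an identity system *)

Section ClosedSets.

Definition bound (env : seq (option word)) (i : nat) : bool :=
  isSome (nth None env i).

Definition env_subst (env : seq (option word)) : word -> word :=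
  subst (fun i => odflt [::] (nth None env i)).

Definition cuts (w : word) : seq nat := iota 0 (size w).+1.

Lemma mem_cuts u v : size u \in cuts (u ++ v).
Proof. by rewrite mem_iota add0n ltnS size_cat leq_addr. Qed.

(* Runs over all ways to match the pattern l with a prefix of w, given the
   values env of the letters already met, and checks K on every outcome. *)
Fixpoint all_matches (K : seq (option word) -> word -> bool) (l : word)
    (env : seq (option word)) (w : word) : bool :=
  if l isn't i :: l' then K env w else
  if nth None env i is Some f then
    prefix f w ==> all_matches K l' env (drop (size f) w)
  else all (fun k => all_matches K l' (set_nth None env i (Some (take k w)))
                       (drop k w)) (cuts w).

Lemma all_matches_cons K i l env w : all_matches K (i :: l) env w =
  if nth None env i is Some f
  then prefix f w ==> all_matches K l env (drop (size f) w)
  else all (fun k => all_matches K l (set_nth None env i (Some (take k w)))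
                       (drop k w)) (cuts w).
Proof. by []. Qed.

(** Tests all rewriting steps by [T], in both directions and at every position, and so certifies
    invariants by computation; a closed singleton is an isoterm. Boundness of the letters of [e.2]
    ensures that a match leaves only finitely many results to test. *)
Definition closedb (W : seq word) (T : seq identity) : bool :=
  all (fun w => all (fun e => all (fun k =>
    all_matches (fun env b => all (bound env) e.2 &&
        (take k w ++ env_subst env e.2 ++ b \in W))
      e.1 [::] (drop k w)) (cuts w))
    (T ++ [seq (e.2, e.1) | e <- T])) W.

Lemma all_matchesP K s l env b :
  (forall i f, nth None env i = Some f -> s i = f) ->
  all_matches K l env (subst s l ++ b) ->
  exists2 env', forall i f, nth None env' i = Some f -> s i = f & K env' b.
Proof.
elim: l env => [|i l IH] env senv; first by exists env.
rewrite all_matches_cons -[subst s (i :: l)]/(s i ++ subst s l) -catA.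
case Ei: (nth None env i) => [f|].
  by rewrite -(senv _ _ Ei) prefix_prefix drop_size_cat // => /IH; apply.
move=> /allP/(_ _ (mem_cuts _ _)).
rewrite take_size_cat // drop_size_cat // => /IH; apply=> j f.
rewrite nth_set_nth /=; case: eqP => [-> [<-] //|_]; exact: senv.
Qed.

Lemma closedb_step W T a b s e : closedb W T ->
  e \in T ++ [seq (e.2, e.1) | e <- T] ->
  a ++ subst s e.1 ++ b \in W -> a ++ subst s e.2 ++ b \in W.
Proof.
rewrite /closedb => /allP cW eT /cW /allP /(_ _ eT) /allP /(_ _ (mem_cuts _ _)).
rewrite take_size_cat // drop_size_cat // =>
  /all_matchesP [i f|env senv /andP[/allP envb]].
  by rewrite nth_nil.
(* All letters of [e.2] are bound, so the default [[::]] in [env_subst] is never read. *)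
suff -> : env_subst env e.2 = subst s e.2 by [].
congr flatten; apply/eq_in_map => i /envb; rewrite /bound.
by case Ei: (nth None env i) => [f|//] _; rewrite (senv _ _ Ei).
Qed.

Lemma closedbP W (T : seq identity) u v : closedb W T ->
  derives (fun e => e \in T) u v -> (u \in W) = (v \in W).
Proof.
move=> cW; elim=> {u v} [//|u v _ <- //|u v w _ -> _ //|a b s e eT].
apply/idP/idP; first by apply: (closedb_step cW); rewrite mem_cat eT.
apply: (@closedb_step W T a b s (e.2, e.1) cW).
by rewrite mem_cat map_f ?orbT.
Qed.

End ClosedSets.

Definition basisN : seq identity := Phi ++ [:: sigma2].
Definition basisM : seq identity :=
  Phi ++ [:: ([:: 0; 1; 2; 0; 1], [:: 1; 0; 2; 0; 1]); sigma2].
Definition basisMd : seq identity := [seq (rev e.1, rev e.2) | e <- basisM].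

(** * Occurrences of letters *)

Section Before.
Variable T : eqType.
Implicit Types (a b c d : T) (p s u v w L : seq T).

(** The index of an absent element is the size of [w], so an element of [w] counts as before every
    absent one. *)
Definition before w a b : bool := index a w < index b w.

Lemma before_trans w : transitive (before w).
Proof. by move=> b a c; apply: ltn_trans. Qed.

Lemma before_asym w a b : before w a b -> before w b a = false.
Proof. by rewrite /before; case: ltngtP. Qed.

Lemma before_neq w a b : before w a b -> a != b.
Proof. by rewrite /before; case: eqP => // ->; rewrite ltnn. Qed.

Lemma before_total w a b : a \in w -> b \in w -> a != b ->
  before w a b || before w b a.
Proof.
move=> aw bw; apply: contraR; rewrite negb_or /before -!leqNgt -eqn_leq.
by move/eqP => e; rewrite -(nth_index a aw) -e nth_index.
Qed.

Lemma before_filter (P : pred T) w a b :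
  P a -> P b -> before (filter P w) a b = before w a b.
Proof.
move=> Pa Pb; rewrite /before; elim: w => //= c w IH.
case: ifP => [Pc|nPc] /=; first by case: eqP; case: eqP.
by case: eqP nPc => [->|_]; [rewrite Pa|case: eqP => [->|]; [rewrite Pb|]].
Qed.

Lemma before_cat p s a b : uniq (p ++ s) -> a \in p -> b \in s ->
  before (p ++ s) a b.
Proof.
rewrite cat_uniq /before !index_cat => /and3P[_ /hasPn ps _] ap bs.
by rewrite ap (negbTE (ps _ bs)) ltn_addr // index_mem.
Qed.

Lemma before_swap p s a b c d : uniq (p ++ a :: b :: s) -> (c, d) != (a, b) ->
  before (p ++ a :: b :: s) c d -> before (p ++ b :: a :: s) c d.
Proof.
rewrite /before !index_cat /= cat_uniq xpair_eqE negb_and /=.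
move=> /and3P[_ _ /and3P[]]; rewrite !inE negb_or => /andP[ab _] _ _ cd.
case: (ifP (c \in p)) => cp; case: (ifP (d \in p)) => dp //; rewrite ?ltn_add2l.
- by move=> _; rewrite ltn_addr // index_mem.
- by move: (index_size d p); lia.
move: cd ab; case: (a =P c); case: (b =P c); case: (a =P d); case: (b =P d);
  move=> ? ? ? ? cd ab; subst; rewrite ?eqxx in cd ab; try lia; try congruence.
Qed.

Lemma before_eq u v : uniq u -> perm_eq u v ->
  (forall a b, a \in u -> b \in u -> before u a b -> before v a b) -> u = v.
Proof.
elim: u v => [|a u IH] v; first by rewrite perm_sym => _ /perm_nilP.
case: v => [|b v]; first by move=> _ /perm_nilP.
move=> auu uv H; have bau : b \in a :: u by rewrite (perm_mem uv) mem_head.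
have ab : a = b.
  apply/eqP/negPn/negP => nab.
  have := H a b (mem_head _ _) bau; rewrite /before /= eqxx (negbTE nab).
  by rewrite eqxx ltn0 => /(_ isT).
subst b; congr (a :: _); move: (auu) => /= /andP[au uu]; apply: IH => //.
  by rewrite perm_cons in uv.
move=> c d cu du cd; have := H c d; rewrite !inE cu du !orbT => /(_ isT isT).
have [nac nad] : a != c /\ a != d.
  by split; apply/eqP => e; move: au; rewrite e ?cu ?du.
by rewrite /before /= (negbTE nac) (negbTE nad) => /(_ cd).
Qed.

(* Bubble sort towards v: pairs in the same order in u and v are never swapped. *)
Lemma trace_connect (R : seq T -> seq T -> Prop) u v :
  (forall w, R w w) -> (forall w1 w2 w3, R w1 w2 -> R w2 w3 -> R w1 w3) ->
  uniq u -> perm_eq u v ->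
  (forall p a b s, perm_eq u (p ++ a :: b :: s) ->
     (forall c d, before u c d -> before v c d ->
        before (p ++ a :: b :: s) c d) ->
     before u a b -> before v b a ->
     R (p ++ a :: b :: s) (p ++ b :: a :: s)) ->
  R u v.
Proof.
move=> Rr Rt uu uv Rs.
pose good L := perm_eq u L /\
  forall c d, before u c d -> before v c d -> before L c d.
have vu : uniq v by rewrite -(perm_uniq uv).
(* The next element [c] of [v] moves left across [l]. Each element it passes comes after [c] in [v],
   hence before [c] in [u] by the invariant [good], so the swap is one of those allowed by [Rs]. *)
have move_front v1 c v2 l l2 : v = v1 ++ c :: v2 ->
    good (v1 ++ l ++ c :: l2) ->
    R (v1 ++ l ++ c :: l2) (v1 ++ c :: l ++ l2) /\ good (v1 ++ c :: l ++ l2).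
  move=> ev; elim/last_ind: l l2 => [|l a IH] l2 //.
  rewrite -!cats1 -!catA /= => -[pL gL].
  have uL : uniq ((v1 ++ l) ++ a :: c :: l2) by rewrite -catA -(perm_uniq pL).
  have av : a \in v.
    by rewrite -(perm_mem uv) (perm_mem pL) !mem_cat inE eqxx !orbT.
  have av2 : a \in v2.
    move: av; rewrite ev mem_cat !inE; case/or3P => // [av1|/eqP ac].
      by move: uL; rewrite cat_uniq => /and3P[_ /hasPn /(_ a)];
        rewrite !inE eqxx mem_cat av1 => /(_ isT).
    by move: uL; rewrite cat_uniq ac /= inE eqxx !andbF.
  have vca : before v c a.
    by rewrite ev -cat_rcons before_cat // ?cat_rcons -?ev // mem_rcons
      mem_head.
  have Lac : before (v1 ++ l ++ [:: a, c & l2]) a c.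
    rewrite catA -cat_rcons before_cat ?cat_rcons //.
      by rewrite mem_rcons mem_head.
    by rewrite mem_head.
  have uac : before u a c.
    have [cu au] : c \in u /\ a \in u.
      by rewrite !(perm_mem pL) !mem_cat !inE !eqxx !orbT.
    have := before_total au cu (before_neq Lac); case/orP => // uca.
    by have := gL _ _ uca vca; rewrite (before_asym Lac).
  have pL' : perm_eq u ((v1 ++ l) ++ [:: c, a & l2]).
    rewrite (perm_trans pL) // -catA !perm_cat2l.
    by rewrite -[[:: a, c & l2]]/([:: a; c] ++ l2) -[[:: c, a & l2]]/([:: c;
      a] ++ l2) perm_cat2r (perm_catC [:: a] [:: c]).
  have [] := IH (a :: l2).
    rewrite catA; split=> // d e ude vde.
    apply: before_swap => //; last by rewrite -catA; apply: gL.
    by apply: contraTneq vde => -[-> ->]; rewrite (before_asym vca).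
  move=> R1 g1; split; last by rewrite -?catA in g1 *.
  apply: Rt R1; rewrite !catA; apply: Rs => //.
    by rewrite -catA.
  by move=> d e; rewrite -catA; apply: gL.
suff H v1 v2 L2 : v = v1 ++ v2 -> good (v1 ++ L2) -> R (v1 ++ L2) v.
  by apply: (H [::] v u).
elim: v2 v1 L2 => [|c v2 IH] v1 L2 ev g.
  have := g.1; rewrite (perm_sym u) => /perm_trans/(_ uv).
  rewrite ev perm_cat2l => /perm_nilP ->; exact: Rr.
have cL : c \in L2.
  have : c \in v1 ++ L2 by rewrite -(perm_mem g.1) (perm_mem uv) ev mem_cat
    mem_head orbT.
  rewrite mem_cat => /orP[cv1|//].
  by move: vu; rewrite ev cat_uniq /= cv1 andbF.
case/splitPr: cL g => l l2 g.
have [R1 g1] := move_front _ _ _ _ _ ev g.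
apply: Rt R1 _; rewrite -cat_rcons; apply: IH; rewrite cat_rcons //.
Qed.

End Before.

Lemma before_map (T T' : eqType) (f : T -> T') (w : seq T) a b :
  {in a :: b :: w &, injective f} ->
  before (map f w) (f a) (f b) = before w a b.
Proof.
move=> fi; have E c : c \in [:: a; b] -> index (f c) (map f w) = index c w.
  move=> cab; have {fi}: {in c :: w &, injective f}.
    move=> d e; rewrite !inE => dw ew; apply: fi; rewrite !inE.
      by move: cab dw; rewrite !inE => /orP[]/eqP -> /orP[] ->; rewrite ?orbT.
    by move: cab ew; rewrite !inE => /orP[]/eqP -> /orP[] ->; rewrite ?orbT.
  elim: w => //= d w IH fi; rewrite IH => [|x y xw yw].
    by rewrite (inj_in_eq fi) // !inE ?eqxx ?orbT.
  by apply: fi; rewrite !inE in xw yw *; [case/orP: xw|case/orP: yw] => ->;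
    rewrite ?orbT.
by rewrite /before !E // !inE eqxx ?orbT.
Qed.

(** * Deletion of letters and numbered occurrences *)

Definition proj (K : seq nat) (w : word) : word :=
  [seq index i K | i <- w & i \in K].

Lemma proj_subst K w :
  proj K w = subst (fun i => if i \in K then [:: index i K] else [::]) w.
Proof.
by elim: w => //= i w IH; rewrite /proj /subst /= -/(subst _ _) -IH; case: ifP.
Qed.

Lemma derives_proj S K u v : derives S u v -> derives S (proj K u) (proj K v).
Proof. by rewrite !proj_subst; apply: derives_subst. Qed.

Fixpoint tokens_from (pre w : word) : seq (nat * nat) :=
  if w is c :: w' then (c, count_mem c pre) :: tokens_from (c :: pre) w'
  else [::].

(* The entry (x, i) stands for the occurrence number i, counted from 0, of the
   letter x. *)
Definition tokens := tokens_from [::].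

Lemma map_tokens w : map fst (tokens w) = w.
Proof. by rewrite /tokens; elim: w [::] => //= c w IH pre; rewrite IH. Qed.

Lemma mem_tokens_from pre w x i : ((x, i) \in tokens_from pre w) =
  (count_mem x pre <= i < count_mem x pre + count_mem x w).
Proof.
elim: w pre => [|c w IH] pre /=; first by rewrite addn0 in_nil; lia.
rewrite inE IH /= xpair_eqE [x == c]eq_sym.
by case: (eqVneq c x) => [->|_] /=; lia.
Qed.

Lemma mem_tokens w x i : ((x, i) \in tokens w) = (i < count_mem x w).
Proof. by rewrite mem_tokens_from. Qed.

Lemma uniq_tokens w : uniq (tokens w).
Proof.
rewrite /tokens; elim: w [::] => //= c w IH pre.
by rewrite IH mem_tokens_from /= eqxx; lia.
Qed.

Lemma before_occ w x i j : i < j < count_mem x w ->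
  before (tokens w) (x, i) (x, j).
Proof.
move=> /andP[ij jw]; rewrite /before /tokens.
have : count_mem x [::] <= i by [].
have : j < count_mem x [::] + count_mem x w by [].
elim: w [::] {jw} => [|c w IH] pre /=; first by lia.
rewrite !xpair_eqE; case: (eqVneq c x) => [->|nx] /= jw iw.
  case: eqP => [_|ni]; case: eqP => [ej|nj] //; try lia.
  by rewrite ltnS; apply: IH; rewrite /= eqxx; lia.
by rewrite ltnS; apply: IH; rewrite /= (negbTE nx); lia.
Qed.

Definition proj_token (K : seq nat) (a : nat * nat) := (index a.1 K, a.2).

Lemma index_inj_in (K : seq nat) x y : x \in K -> y \in K -> index x K =
  index y K -> x = y.
Proof. by move=> xK yK e; rewrite -(nth_index 0 xK) e nth_index. Qed.

(** Deleting other letters does not change the number of an occurrence, since only equal letters are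
    counted. *)
Lemma tokens_proj K w :
  tokens (proj K w) = [seq proj_token K a | a <- tokens w & a.1 \in K].
Proof.
rewrite /tokens -[[::] in LHS]/(proj K [::]).
elim: w [::] => //= c w IH pre.
rewrite /proj /= -/(proj K w); case: ifP => [cK|nK] /=; last first.
  by rewrite -IH /proj /= nK.
congr (_ :: _); last by rewrite -IH /proj /= cK.
congr pair; rewrite count_map count_filter; apply: eq_count => i /=.
apply/andP/eqP => [[/eqP e iK]|-> //]; exact: index_inj_in e.
Qed.

Lemma before_proj K w a b : a.1 \in K -> b.1 \in K ->
  before (tokens (proj K w)) (proj_token K a) (proj_token K b) =
  before (tokens w) a b.
Proof.
move=> aK bK; rewrite tokens_proj before_map ?before_filter //.
have H : {subset [:: a,
  b & [seq x <- tokens w | x.1 \in K]] <= [pred c | c.1 \in K]}.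
  by move=> c; rewrite !inE mem_filter => /or3P[/eqP->|/eqP->|/andP[]].
move=> [c i] [d j] /H /= cK /H /= dK [e ->]; congr pair; exact: index_inj_in e.
Qed.

Lemma eq_proj_before K u v a b : proj K u = proj K v -> a.1 \in K ->
  b.1 \in K -> before (tokens u) a b = before (tokens v) a b.
Proof. by move=> e aK bK; rewrite -!(before_proj _ aK bK) e. Qed.

Lemma count_proj K w x : x \in K ->
  count_mem (index x K) (proj K w) = count_mem x w.
Proof.
move=> xK; rewrite count_map count_filter; apply: eq_count => i /=.
apply/andP/eqP => [[/eqP e iK]|-> //]; exact: index_inj_in e.
Qed.

Lemma count_proj_lt K w i : uniq K -> i < size K ->
  count_mem i (proj K w) = count_mem (nth 0 K i) w.
Proof. by move=> uK iK; rewrite -(count_proj w (mem_nth 0 iK)) index_uniq. Qed.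

Lemma proj_lt K w : all (gtn (size K)) (proj K w).
Proof.
apply/allP => c /mapP[i]; rewrite mem_filter => /andP[iK _] -> /=.
by rewrite index_mem.
Qed.

Fixpoint words (n k : nat) : seq word :=
  if k is k'.+1 then allpairs cons (iota 0 n) (words n k') else [:: [::]].

Lemma mem_words n w : all (gtn n) w -> w \in words n (size w).
Proof.
elim: w => //= c w IH /andP[cn /IH ww].
by apply: allpairs_f => //; rewrite mem_iota.
Qed.

Lemma size_proj K w : uniq K ->
  size (proj K w) = sumn [seq count_mem x w | x <- K].
Proof.
move=> uK; rewrite size_map size_filter; elim: K uK => [|x K IH] /=.
  by elim: w.
move=> /andP[xK /IH <-]; elim: w {IH} => //= c w ->; rewrite inE.
case: (eqVneq c x) => [->|_] /=; first by rewrite (negbTE xK); lia.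
by lia.
Qed.

Local Notation derivesN := (derives (fun e => e \in basisN)).
Local Notation derivesMd := (derives (fun e => e \in basisMd)).

Lemma proj_cat K u v : proj K (u ++ v) = proj K u ++ proj K v.
Proof. by rewrite /proj filter_cat map_cat. Qed.

Lemma proj_nil K w : {in w, forall c, c \notin K} -> proj K w = [::].
Proof.
elim: w => //= c w IH H; rewrite /proj /= (negbTE (H c (mem_head _ _))).
by apply: IH => d dw; apply: H; rewrite inE dw orbT.
Qed.

Lemma eq_tokens_sorted w w0 : (forall x, count_mem x w0 = count_mem x w) ->
  sorted (before (tokens w)) (tokens w0) -> w = w0.
Proof.
move=> cw sw; rewrite -(map_tokens w) -(map_tokens w0); congr map.
apply/esym/before_eq; first exact: uniq_tokens.
  apply: uniq_perm; try exact: uniq_tokens.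
  by move=> [x i]; rewrite !mem_tokens cw.
move=> a b aw bw; apply: (sorted_ltn_index _ sw) => //; exact: before_trans.
Qed.

(** A word is determined by its letter counts and the order of its tokens; for a literal [w0] the
    [sorted] premise unfolds into finitely many comparisons in [w]. *)
Lemma proj_eq K w w0 : uniq K -> all (gtn (size K)) w0 ->
  [seq count_mem x w | x <- K] = [seq count_mem i w0 | i <- iota 0 (size K)] ->
  sorted (fun a b => before (tokens w) (nth 0 K a.1, a.2) (nth 0 K b.1, b.2))
    (tokens w0) ->
  proj K w = w0.
Proof.
move=> uK w0K ec s0; apply: eq_tokens_sorted => [i|].
  case: (ltnP i (size K)) => iK.
    rewrite count_proj_lt //; have := congr1 (nth 0 ^~ i) ec.
    by rewrite (nth_map 0) // (nth_map 0) ?size_iota // nth_iota // add0n => ->.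
  rewrite !(count_memPn _) //; apply/negP.
    by move/(allP (proj_lt K w)); rewrite /= ltnNge iK.
  by move/(allP w0K); rewrite /= ltnNge iK.
apply: (@sub_in_sorted _ [pred a | a.1 < size K] _ _ _ _ _ s0) => /=.
  move=> [i k] [j l]; rewrite !inE /= => iK jK.
  rewrite -(@before_proj K) ?mem_nth //.
  by rewrite /proj_token /= !index_uniq.
apply/allP => -[i k]; rewrite mem_tokens /= => kw.
apply: (allP w0K); rewrite -has_pred1 has_count; exact: leq_ltn_trans kw.
Qed.

(** * Invariants of N *)

Section InvariantsN.
Variables u v : word.
Hypothesis uv : derivesN u v.

Lemma closed_proj W K : closedb W basisN -> proj K u \in W -> proj K v \in W.
Proof. by move=> cW; rewrite (closedbP cW (derives_proj K uv)). Qed.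

(** The way isoterms of [N] are used: derivations survive the deletion of letters. *)
Lemma isoterm_proj w K : closedb [:: w] basisN -> proj K u = w -> proj K v = w.
Proof.
by move=> cw e; have := closed_proj cw (K := K);
  rewrite !inE e eqxx => /(_ isT)/eqP.
Qed.

Lemma proj_singleton x w : proj [:: x] w = nseq (count_mem x w) 0.
Proof.
have -> : count_mem x w = size (proj [:: x] w) by rewrite size_proj //= addn0.
by apply/all_pred1P/allP => i /(allP (proj_lt _ _)) /=; case: i.
Qed.

Lemma countN x : count_mem x u <= 1 -> count_mem x v = count_mem x u.
Proof.
have sz w : size (proj [:: x] w) = count_mem x w by rewrite proj_singleton
  size_nseq.
case: (count_mem x u) (sz u) (proj_singleton x u) => [|[|//]] _ e _.
  by rewrite -sz (isoterm_proj _ e).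
by rewrite -sz (isoterm_proj _ e).
Qed.

End InvariantsN.

(* The second disjunct: x occurs exactly twice, and t once, in between. *)
Definition core (w : word) (x : nat) : Prop :=
  count_mem x w <= 1 \/ exists t, proj [:: x; t] w = [:: 0; 1; 0].

Lemma proj_dbl w x t : proj [:: x; t] w = [:: 0; 1; 0] ->
  [/\ x != t, count_mem x w = 2 & count_mem t w = 1].
Proof.
move=> e; have xt : x != t.
  apply/eqP => xt; have : 1 \in proj [:: x; t] w by rewrite e.
  by case/mapP => c; rewrite mem_filter xt !inE orbb => /andP[/eqP ->] _ /=;
    rewrite eqxx.
have := @count_proj_lt [:: x; t] w 0; have := @count_proj_lt [:: x; t] w 1.
by rewrite e /= inE xt /= => <- // <-.
Qed.

Section CoreLetters.
Variables u v : word.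
Hypothesis uv : derivesN u v.

Lemma core_count x : core u x -> count_mem x v = count_mem x u.
Proof.
case=> [xu|[t e]]; first exact: countN.
have /proj_dbl[_ -> _] := isoterm_proj uv (w := [:: 0; 1; 0]) isT e.
by case/proj_dbl: e => _ ->.
Qed.

Lemma core_derivesN x : core u x -> core v x.
Proof.
case=> [xu|[t e]]; first by left; rewrite (countN uv).
by right; exists t; apply: (isoterm_proj uv).
Qed.

(** The four words obtained by inserting a new simple letter into [xtx] are isoterms of [N];
    exhaustive check. *)
Lemma closed_xtxs : all (fun w => (proj [:: 0; 1] w == [:: 0; 1; 0]) &&
  (count_mem 2 w == 1) ==> closedb [:: w] basisN) (words 3 4).
Proof. by vm_compute. Qed.

Lemma proj_proj2 x t s w : x != t -> x != s -> t != s ->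
  proj [:: 0; 1] (proj [:: x; t; s] w) = proj [:: x; t] w.
Proof.
move=> xt xs ts; elim: w => // c w IH; rewrite -[c :: w]cat1s !proj_cat IH.
congr (_ ++ _); rewrite /proj /= !inE.
have [->|nx] /= := eqVneq c x; first by rewrite eqxx.
have [->|nt] /= := eqVneq c t; first by rewrite eqxx (negbTE xt).
by have [->|] //= := eqVneq c s; rewrite eqxx (negbTE xs) (negbTE ts).
Qed.

(** Keeping only [x], [s] and, if needed, a simple letter between the two occurrences of [x] leaves
    one of [x], [xs], [sx], [xtx] or [xtx] with [s] inserted, all isoterms of [N]. Hence [N] fixes
    the place of each core occurrence relative to each simple letter. *)
Lemma simple_isoterm x s : core u x -> 0 < count_mem x u -> count_mem s u = 1 ->
  exists K, [/\ x \in K, s \in K & proj K u = proj K v].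
Proof.
move=> cx x0 s1; have [exs|xs] := eqVneq x s.
  exists [:: x]; rewrite -exs !inE eqxx; split=> //; apply/esym.
  by apply: (isoterm_proj uv _ (erefl _)); rewrite proj_singleton exs s1.
case: cx => [x1|[t e]].
  exists [:: x; s]; rewrite !inE !eqxx orbT; split=> //; apply/esym.
  apply: (isoterm_proj uv _ (erefl _)).
  have uK : uniq [:: x; s] by rewrite /= inE xs.
  have {}x1 : count_mem x u = 1 by lia.
  have := mem_words (proj_lt [:: x; s] u); rewrite size_proj //= s1 x1.
  have := @count_proj_lt [:: x; s] u 0 uK isT; rewrite /= x1.
  move: (proj [:: x; s] u) => w.
  by rewrite !inE => + ww; case/or4P: ww => /eqP ->; vm_compute.
case: (proj_dbl e) => xt x2 t1.
have [ets|ts] := eqVneq t s.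
  exists [:: x; t]; rewrite !inE ets !eqxx orbT; split=> //; apply/esym.
  by rewrite -ets e; apply: (isoterm_proj uv).
exists [:: x; t; s]; rewrite !inE !eqxx !orbT; split=> //; apply/esym.
apply: (isoterm_proj uv _ (erefl _)).
have uK : uniq [:: x; t; s] by rewrite /= !inE negb_or xt xs ts.
have := mem_words (proj_lt [:: x; t; s] u).
rewrite size_proj //= x2 t1 s1 => wK.
have := allP closed_xtxs _ wK; rewrite (proj_proj2 _ xt xs ts) e eqxx /=.
by have := @count_proj_lt [:: x; t; s] u 2 uK isT => /= ->; rewrite s1.
Qed.

Lemma before_simple x i s : core u x -> i < count_mem x u -> count_mem s u =
  1 ->
  before (tokens u) (x, i) (s, 0) = before (tokens v) (x, i) (s, 0) /\
  before (tokens u) (s, 0) (x, i) = before (tokens v) (s, 0) (x, i).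
Proof.
move=> cx ix s1; have [|K [xK sK e]] := simple_isoterm cx _ s1.
  exact: leq_ltn_trans ix.
by rewrite !(eq_proj_before e).
Qed.

(** The set of $xyzxy$ and $xyzyx$ is closed under the identities of [N], and both words start with
    [x], [y]. *)
Lemma before_first x y z : x != y -> y != z -> x != z ->
  proj [:: x; y; z] u = [:: 0; 1; 2; 0; 1] ->
  before (tokens v) (x, 0) (y, 0).
Proof.
move=> xy yz xz e; have := @closed_proj _ _ uv [:: [:: 0;1;2;0;1];
  [:: 0;1;2;1;0]] [:: x; y; z].
rewrite e mem_head => /(_ isT isT) vW.
rewrite -(@before_proj [:: x; y; z]) ?inE ?eqxx ?orbT //.
rewrite /proj_token /= eqxx (negbTE xy) eqxx.
by move: vW; rewrite !inE => /orP[]/eqP ->.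
Qed.

End CoreLetters.

(** * Consequences of the identities of the dual of M *)

Definition vals (X Y Z T : word) (i : nat) : word :=
  nth [::] [:: X; Y; Z; T] i.

Lemma step_in (S : seq identity) a b X Y Z T e : e \in S ->
  derives (fun e => e \in S) (a ++ subst (vals X Y Z T) e.1 ++ b)
                             (a ++ subst (vals X Y Z T) e.2 ++ b).
Proof. exact: derives_step. Qed.

Lemma split_first (x : nat) (w : word) :
  x \in w -> exists a b, w = a ++ x :: b /\ x \notin a.
Proof.
move=> xw; exists (take (index x w) w), (drop (index x w).+1 w).
by rewrite -drop_index // cat_take_drop in_take // ltnn.
Qed.

Section RulesMd.
Implicit Types (a b r w : word) (x e : nat).

(** If [e] occurs earlier, this is the mirror image of [sigma3]; if [e] recurs later, the mirror
    image of [sigma2], its letters assigned according to whether [x] or [e] recurs first. *)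
Lemma swap_first a r x e : x \in r -> (e \in a) || (e \in r) ->
  derivesMd (a ++ [:: x; e] ++ r) (a ++ [:: e; x] ++ r).
Proof.
move=> xr; have [->|nex] := eqVneq e x; first by move=> _; apply: derives_refl.
case: (boolP (e \in a)) => [/splitPr[a1 a2] _|_ /= er].
  case/splitPr: xr => r1 r2.
  have := @step_in basisMd a1 r2 [:: x] [:: e] r1 a2
    ([:: 1; 3; 1; 0; 2; 0], [:: 1; 3; 0; 1; 2; 0]) isT.
  by rewrite /subst /= -!catA /= -!catA; apply: derives_sym.
case/splitPr: xr er => r1 r2; rewrite mem_cat inE (negbTE nex) /=.
case/orP => /splitPr[r3 r4].
  have := @step_in basisMd a r2 [:: x] [:: e] r3 r4
    ([:: 1; 0; 2; 1; 3; 0], [:: 0; 1; 2; 1; 3; 0]) isT.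
  by rewrite /subst /= -!catA /= -!catA; apply: derives_sym.
have := @step_in basisMd a r4 [:: e] [:: x] r1 r3
  ([:: 1; 0; 2; 1; 3; 0], [:: 0; 1; 2; 1; 3; 0]) isT.
by rewrite /subst /= -!catA /= -!catA.
Qed.

Lemma move_first a b r x : x \in r ->
  (forall e, e \in b -> e != x -> 2 <= count_mem e (a ++ b ++ r)) ->
  derivesMd (a ++ x :: b ++ r) (a ++ b ++ x :: r).
Proof.
move=> xr; elim: b a => [|e b IH] a H /=; first exact: derives_refl.
apply: (derives_trans (rcons a e ++ x :: b ++ r)).
  rewrite cat_rcons; have [->|nex] := eqVneq e x; first exact: derives_refl.
  apply: swap_first; first by rewrite mem_cat xr orbT.
  have := H e (mem_head _ _) nex; rewrite !count_cat /= eqxx.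
  rewrite -!has_pred1 !has_count count_cat. move: (count_mem e a) (count_mem
    e b) (count_mem e r) => i j k. lia.
rewrite -[a ++ e :: _]cat_rcons; apply: IH => d db dx.
by have := H d; rewrite inE db orbT => /(_ isT dx); rewrite cat_rcons.
Qed.

Lemma square_front a b x : derivesMd (a ++ [:: x; x] ++ b) ([:: x;
  x] ++ a ++ b).
Proof.
have := @step_in basisMd [::] b [:: x] a [::] [::] ([:: 1; 0; 0], [:: 0; 0;
  1]) isT.
by rewrite /subst /= -!catA.
Qed.

(** Squares are central, and the mirror image of $x^2yz\approx xyxzx$ with [y] and [z] erased is
    $x^2\approx x^3$; so the square travels through [w] and swallows each [x]. *)
Lemma square_absorb w x :
  derivesMd ([:: x; x] ++ w) ([:: x; x] ++ filter (predC1 x) w).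
Proof.
elim: w => [|c w IH]; first exact: derives_refl.
rewrite /=; have [->|ncx] /= := eqVneq c x.
  apply: (derives_trans _ _ IH).
  have := @step_in basisMd [::] w [:: x] [::] [::] [::]
    ([:: 2; 1; 0; 0], [:: 0; 2; 0; 1; 0]) isT.
  by rewrite /subst /=; apply: derives_sym.
apply: (derives_trans ([:: c; x; x] ++ w)).
  exact/derives_sym/(square_front [:: c]).
apply: (derives_trans ([:: c; x; x] ++ filter (predC1 x) w)).
  by have := derives_ctx [:: c] [::] IH; rewrite !cats0.
exact: (square_front [:: c]).
Qed.

(** With three occurrences of [x], the mirror image of $x^2yz\approx xyxzx$ makes two of them
    adjacent. With exactly two, no letter in between is simple because [x] is not core, so
    [move_first] brings the first occurrence next to the second. *)
Lemma extract_square w x : ~ core w x ->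
  derivesMd w ([:: x; x] ++ filter (predC1 x) w).
Proof.
move=> ncx; suff [a [b ab]] : exists a b, derivesMd w (a ++ [:: x; x] ++ b) /\
    filter (predC1 x) (a ++ b) = filter (predC1 x) w.
  apply: (derives_trans (a ++ [:: x; x] ++ b)); first exact: ab.1.
  apply: (derives_trans ([:: x; x] ++ a ++ b)); first exact: square_front.
  by rewrite -ab.2; apply: square_absorb.
have xw : 1 < count_mem x w by rewrite ltnNge; apply/negP => xw; apply: ncx;
  left.
have [a [w1 [def_w xa]]] : exists a w1, w = a ++ x :: w1 /\ x \notin a.
  by apply: split_first; rewrite -has_pred1 has_count; lia.
have ca : count_mem x a = 0 by apply/count_memPn.
have [b [c [def_w1 xb]]] : exists b c, w1 = b ++ x :: c /\ x \notin b.
  apply: split_first; rewrite -has_pred1 has_count.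
  by move: xw; rewrite def_w count_cat ca /= eqxx; lia.
have cb : count_mem x b = 0 by apply/count_memPn.
rewrite {}def_w1 in def_w; have [xc|xc] := boolP (x \in c).
  case/splitPr: xc def_w => c1 c2 ->; exists (a ++ b ++ c1), c2; split.
    have := @step_in basisMd a c2 [:: x] c1 b [::]
      ([:: 2; 1; 0; 0], [:: 0; 2; 0; 1; 0]) isT.
    by rewrite /subst /= -!catA /= -!catA; apply: derives_sym.
  by do 3![rewrite ?filter_cat /= ?eqxx /=]; rewrite !catA.
have cc : count_mem x c = 0 by apply/count_memPn.
exists (a ++ b), c; split.
  2: by rewrite def_w; do 3![rewrite ?filter_cat /= ?eqxx /=]; rewrite !catA.
rewrite def_w -catA; apply: move_first; first by rewrite mem_head.
move=> e eb nex; rewrite leqNgt; apply/negP => e1; apply: ncx; right; exists e.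
have [b1 [b2 [def_b eb1]]] := split_first eb.
have e0 : count_mem e (a ++ b1 ++ b2 ++ c) = 0.
  by move: e1; rewrite def_b; do 3![rewrite ?count_cat /= ?eqxx /=]; lia.
have H d : d \in a ++ b1 ++ b2 ++ c -> d \notin [:: x; e].
  move=> dw; rewrite !inE negb_or; apply/andP; split; last first.
    by apply: contraTneq dw => ->; apply/count_memPn.
  apply: contraTneq dw => ->; rewrite -has_pred1 has_count.
  by move: cb; rewrite def_b !count_cat /= ca cc; lia.
rewrite def_w def_b -!catA /= -(cat1s x (b1 ++ _)) -(cat1s e (b2 ++ _))
  -(cat1s x c) !proj_cat.
rewrite !(@proj_nil _ a, @proj_nil _ b1, @proj_nil _ b2, @proj_nil _ c) /=;
  try by move=> d dw; apply: H; rewrite !mem_cat dw ?orbT.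
by rewrite /proj /= !inE !eqxx orbT /= !eqxx [x == e]eq_sym (negbTE nex).
Qed.

End RulesMd.

(** Without a simple letter between them, the first occurrences can be made adjacent; then the
    mirror image of $xyzxy\approx yxzxy$ swaps the second ones, and [x] moves back. *)
Lemma swap_second p1 x p2 y p3 s :
  (forall e, e \in p2 -> e != x ->
     2 <= count_mem e (p1 ++ p2 ++ y :: p3 ++ [:: x, y & s])) ->
  derivesMd (p1 ++ x :: p2 ++ y :: p3 ++ [:: x, y & s])
            (p1 ++ x :: p2 ++ y :: p3 ++ [:: y, x & s]).
Proof.
move=> H; apply: (derives_trans (p1 ++ p2 ++ x :: y :: p3 ++ [:: x, y & s])).
  by apply: move_first => //; rewrite inE mem_cat inE eqxx !orbT.
apply: (derives_trans (p1 ++ p2 ++ x :: y :: p3 ++ [:: y, x & s])).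
  have := @step_in basisMd (p1 ++ p2) s [:: y] [:: x] p3 [::]
    ([:: 1; 0; 2; 1; 0], [:: 1; 0; 2; 0; 1]) isT.
  by rewrite /subst /= -!catA.
apply/derives_sym/move_first; first by rewrite inE mem_cat !inE eqxx !orbT.
move=> e ep nex; have := H e ep nex; do 2![rewrite !count_cat /=]; lia.
Qed.

Lemma before_mem_prefix (T : eqType) (p s : seq T) a c : uniq (p ++ a :: s) ->
  before (p ++ a :: s) c a -> c \in p.
Proof.
rewrite cat_uniq /before !index_cat /= eqxx addn0 negb_or.
by move=> /and3P[_ /andP[/negbTE -> _] _]; case: ifP => // _; lia.
Qed.

Lemma before_mem_suffix (T : eqType) (p s : seq T) b c : uniq (p ++ b :: s) ->
  c \in p ++ b :: s -> before (p ++ b :: s) b c -> c \in s.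
Proof.
move=> us; rewrite mem_cat inE => /or3P[cp|/eqP->|//];
  last by rewrite /before ltnn.
rewrite before_asym // before_cat ?mem_head //.
Qed.

(** * Theories of varieties that contain [N] and violate [sigma2] *)

Section CompletenessMd.
Variable theta : word -> word -> Prop.
Hypothesis theta_sym : forall u v, theta u v -> theta v u.
Hypothesis theta_subst :
  forall r u v, theta u v -> theta (subst r u) (subst r v).
Hypothesis theta_N : forall u v, theta u v -> derivesN u v.
Hypothesis theta_sigma2 : ~ theta sigma2.1 sigma2.2.

Lemma dbl_of_core w x : core w x -> 1 < count_mem x w ->
  exists t, proj [:: x; t] w = [:: 0; 1; 0].
Proof. by case=> [|//]; rewrite leqNgt => /negbTE ->. Qed.

Lemma before_dbl w x t : proj [:: x; t] w = [:: 0; 1; 0] ->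
  before (tokens w) (x, 0) (t, 0) /\ before (tokens w) (t, 0) (x, 1).
Proof.
move=> e; have [xt _ _] := proj_dbl e.
have xK : x \in [:: x; t] by rewrite inE eqxx.
have tK : t \in [:: x; t] by rewrite !inE eqxx orbT.
rewrite -(@before_proj [:: x; t] w (x, 0) (t, 0)) //.
rewrite -(@before_proj [:: x;
  t] w (t, 0) (x, 1)) // e /proj_token /= eqxx (negbTE xt) eqxx.
by [].
Qed.

(** Otherwise keeping only [x], [y], [t] and a simple letter [z] between the two occurrences of [y]
    turns the identity into [sigma2]. *)
Lemma second_order_agree u v x y t : theta u v ->
  core u x -> core u y -> 1 < count_mem x u -> 1 < count_mem y u ->
  count_mem t u = 1 ->
  before (tokens u) (x, 0) (t, 0) -> before (tokens u) (t, 0) (y, 0) ->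
  before (tokens u) (x, 1) (y, 1) -> before (tokens v) (y, 1) (x, 1) -> False.
Proof.
move=> uv cx cy x2 y2 t1 xt ty uxy vyx; have uvN := theta_N uv.
have [z ez] := dbl_of_core cy y2; have [yz cy2 z1] := proj_dbl ez.
have [t' /proj_dbl[_ cx2 _]] := dbl_of_core cx x2.
have ez' := isoterm_proj uvN (w := [:: 0; 1; 0]) isT ez.
have [uyz uzy] := before_dbl ez; have [vyz vzy] := before_dbl ez'.
have sz i : i < 2 -> _ := fun h => before_simple uvN cx (leq_trans h x2) z1.
have st i : i < 2 -> _ := fun h => before_simple uvN cx (leq_trans h x2) t1.
have sty i : i < 2 -> _ := fun h => before_simple uvN cy (leq_trans h y2) t1.
have xz : x != z by apply: contraTneq x2 => ->; rewrite z1.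
have nxt : x != t by apply: contraTneq x2 => ->; rewrite t1.
have nyt : y != t by apply: contraTneq y2 => ->; rewrite t1.
have xy : x != y by apply: contraTneq uxy => ->; rewrite /before ltnn.
have tz : z != t.
  apply/eqP => e; subst t.
  by have := before_asym (before_trans ty uyz); rewrite (before_trans ty uyz).
(* If the second [x] preceded [z] in [u], it would do so in [v], and there it would precede the
   second [y]. *)
have uzx : before (tokens u) (z, 0) (x, 1).
  have /orP[uxz|//] : before (tokens u) (x, 1) (z,
    0) || before (tokens u) (z, 0) (x, 1).
    by apply: before_total; rewrite ?mem_tokens ?z1 // xpair_eqE (negbTE xz).
  have vxz : before (tokens v) (x, 1) (z, 0) by rewrite -(sz 1 _).1.
  by have := before_asym (before_trans vxz vzy); rewrite vyx.
have vzx : before (tokens v) (z, 0) (x, 1) by rewrite -(sz 1 _).2.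
have vxt : before (tokens v) (x, 0) (t, 0) by rewrite -(st 0 _).1.
have vty : before (tokens v) (t, 0) (y, 0) by rewrite -(sty 0 _).2.
have ct : core u t by left; rewrite t1.
have cz : core u z by left; rewrite z1.
have uK : uniq [:: x; y; z; t].
  by rewrite /= !inE !negb_or xy xz nxt yz nyt tz.
apply: theta_sigma2.
have <- : proj [:: x; y; z; t] u = sigma2.1.
  apply: proj_eq => //; first by rewrite /= cx2 cy2 z1 t1.
  by rewrite /= xt ty uyz uzx uxy.
have <- : proj [:: x; y; z; t] v = sigma2.2.
  apply: proj_eq => //.
    by rewrite /= !(core_count uvN) // cx2 cy2 z1 t1.
  by rewrite /= vxt vty vyz vzy vyx.
by rewrite !proj_subst; apply: theta_subst.
Qed.

(** By [trace_connect] it is enough to swap adjacent occurrences that [u] and [v] order differently.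
    Neither letter is simple. If one of the occurrences is a first one, [swap_first] applies; if
    both are second, [swap_second] does, because a simple letter between the first occurrences would
    contradict [second_order_agree]. *)
Lemma core_complete u v : theta u v -> (forall x, core u x) -> derivesMd u v.
Proof.
move=> uv cu; have uvN := theta_N uv.
have cuv x : count_mem x v = count_mem x u by apply: core_count.
rewrite -(map_tokens u) -(map_tokens v).
apply: (@trace_connect _ (fun L L' => derivesMd (map fst L) (map fst L'))).
- by move=> w; apply: derives_refl.
- by move=> w1 w2 w3 H1 H2; apply: derives_trans H2.
- exact: uniq_tokens.
- apply: uniq_perm; try exact: uniq_tokens.
  by move=> [x i]; rewrite !mem_tokens cuv.
move=> p [x i] [y j] s uL gL uxy vyx; set L := p ++ _ in uL gL.
have uniqL : uniq L by rewrite -(perm_uniq uL) uniq_tokens.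
have memL c k : ((c, k) \in L) = (k < count_mem c u).
  by rewrite -(perm_mem uL) mem_tokens.
have /[!memL] ix : (x, i) \in L by rewrite mem_cat mem_head orbT.
have /[!memL] jy : (y, j) \in L by rewrite mem_cat !inE eqxx !orbT.
have xy : x != y.
  apply/eqP => e; subst y; have := before_neq uxy; rewrite xpair_eqE eqxx /=.
  case: ltngtP => // ij _.
    by move: vyx; rewrite before_asym // before_occ // ij cuv.
  by move: uxy; rewrite before_asym // before_occ // ij.
have x2 : 1 < count_mem x u.
  rewrite ltnNge; apply/negP => x1; have {}x1 : count_mem x u = 1 by lia.
  have i0 : i = 0 by lia.
  subst i; move: vyx; rewrite -(before_simple uvN (cu y) jy x1).1.
  by rewrite (before_asym uxy).
have y2 : 1 < count_mem y u.
  rewrite ltnNge; apply/negP => y1; have {}y1 : count_mem y u = 1 by lia.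
  have j0 : j = 0 by lia.
  subst j; move: vyx; rewrite -(before_simple uvN (cu x) ix y1).2.
  by rewrite (before_asym uxy).
have c2 c : count_mem c u <= 2.
  case: (leqP (count_mem c u) 1) => [/leq_trans -> //|/(dbl_of_core (cu c))[t]].
  by case/proj_dbl => _ ->.
have occL c : 1 < count_mem c u -> before L (c, 0) (c, 1).
  by move=> hc; apply: gL; apply: before_occ; rewrite ?cuv.
have yS : j = 0 -> y \in map fst s.
  move=> j0; subst j; apply/mapP; exists (y, 1) => //.
  apply: (@before_mem_suffix _ (rcons p (x, i)) _ (y, 0)); rewrite cat_rcons //.
    by rewrite memL.
  exact: occL.
have xS : i = 0 -> x \in map fst s.
  move=> i0; subst i; apply/mapP; exists (x, 1) => //.
  have : (x, 1) \in (y, j) :: s.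
    apply: (@before_mem_suffix _ p _ (x, 0)); rewrite // ?memL //; exact: occL.
  by rewrite inE xpair_eqE (negbTE xy).
have xP : i = 1 -> (x, 0) \in p.
  by move=> i1; subst i; apply: (before_mem_prefix uniqL); apply: occL.
have yP : j = 1 -> (y, 0) \in p.
  move=> j1; subst j; have : (y, 0) \in rcons p (x, i).
    apply: (@before_mem_prefix _ _ s (y, 1)); rewrite cat_rcons //; exact: occL.
  by rewrite mem_rcons inE xpair_eqE eq_sym (negbTE xy).
rewrite !map_cat /=.
have [i0|i1] : i = 0 \/ i = 1 by have := c2 x; clear -ix; lia.
  apply: (swap_first (xS i0)).
  have [j0|j1] : j = 0 \/ j = 1 by have := c2 y; clear -jy; lia.
    by rewrite yS ?orbT.
  by rewrite (map_f fst (yP j1)).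
have [j0|j1] : j = 0 \/ j = 1 by have := c2 y; clear -jy; lia.
  apply/derives_sym/(swap_first (yS j0)).
  by rewrite (map_f fst (xP i1)).
subst i j.
(* A simple letter between two first occurrences in the intermediate word [L] is between them in [u]
   and [v] too: these agree on comparisons with simple letters, and [L] keeps every order they
   share. *)
have separated (a b : nat) p1 p2 p3 (e : nat) : p = p1 ++ (a,
  0) :: p2 ++ (b, 0) :: p3 ->
    e \in map fst p2 ->
    count_mem e u = 1 ->
    [/\ before (tokens u) (a, 0) (e, 0), before (tokens u) (e, 0) (b, 0),
        before (tokens v) (a, 0) (e, 0) & before (tokens v) (e, 0) (b, 0)].
  move=> def_p /mapP[[e' k] ek /= ee]; subst e' => e1.
  have memp c k' : (c, k') \in p -> k' < count_mem c u.
    by rewrite -memL mem_cat => ->.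
  have /memp k1 : (e, k) \in p by rewrite def_p !(mem_cat, inE) ek !orbT.
  have {k1}/eqP k0 : k == 0 by rewrite -leqn0 -ltnS -e1.
  subst k.
  have a0 : 0 < count_mem a u by apply: memp;
    rewrite def_p !(mem_cat, inE) eqxx !orbT.
  have b0 : 0 < count_mem b u by apply: memp;
    rewrite def_p !(mem_cat, inE) eqxx !orbT.
  have [ae1 ae2] := before_simple uvN (cu a) a0 e1.
  have [be1 be2] := before_simple uvN (cu b) b0 e1.
  have eL : L = p1 ++ (a, 0) :: p2 ++ (b, 0) :: p3 ++ [:: (x, 1), (y, 1) & s].
    by rewrite /L def_p -!catA /= -!catA.
  have Lae : before L (a, 0) (e, 0).
    rewrite eL -cat_rcons before_cat //.
    - by rewrite cat_rcons -eL.
    - by rewrite mem_rcons mem_head.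
    by rewrite mem_cat ek.
  have Leb : before L (e, 0) (b, 0).
    rewrite eL -cat_cons catA before_cat //.
    - by rewrite -catA -eL.
    - by rewrite mem_cat inE ek !orbT.
    by rewrite mem_head.
  have agree c d : c \in tokens u -> d \in tokens u -> before L c d ->
      before (tokens u) c d = before (tokens v) c d ->
      before (tokens u) d c = before (tokens v) d c ->
      before (tokens u) c d /\ before (tokens v) c d.
    move=> cu' du' Lcd e2 e3.
    case/orP: (before_total cu' du' (before_neq Lcd)) => h.
      by rewrite -e2.
    by have := gL _ _ h; rewrite -e3 h (before_asym Lcd) => /(_ isT).
  have tok c : 0 < count_mem c u -> (c, 0) \in tokens u by rewrite mem_tokens.
  have [] := agree _ _ (tok _ a0) (tok e _) Lae ae1 ae2; first by rewrite e1.
  have [] // := agree _ _ (tok e _) (tok _ b0) Leb be2 be1; by rewrite e1.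
have count_L (e : nat) : count_mem e (map fst L) = count_mem e u.
  rewrite -[u in RHS]map_tokens; apply/permP/perm_map; by rewrite perm_sym.
have pL0 : (x, 0) \in p /\ (y, 0) \in p by split; [apply: xP | apply: yP].
have split2 (a b : nat) : (a, 0) \in p -> (b, 0) \in p -> before p (a,
  0) (b, 0) ->
    exists p1 p2 p3, p = p1 ++ (a, 0) :: p2 ++ (b, 0) :: p3.
  have : uniq p by move: uniqL; rewrite /L cat_uniq => /and3P[].
  move=> + ap bp; case/splitPr: ap bp => p1 q bp up pab.
  move: bp; rewrite mem_cat inE => /or3P[bp|/eqP e|].
  - by have := before_cat up bp (mem_head _ _); rewrite (before_asym pab).
  - by move: pab; rewrite e /before ltnn.
  by case/splitPr => p2 p3; exists p1, p2, p3.
have : before p (x, 0) (y, 0) || before p (y, 0) (x, 0).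
  by apply: before_total pL0.1 pL0.2 _; rewrite xpair_eqE (negbTE xy).
case/orP => /split2 H.
- have [p1 [p2 [p3 def_p]]] := H pL0.1 pL0.2.
  have sep := separated _ _ _ _ _ _ def_p.
  rewrite def_p map_cat /= map_cat /= -!catA /= -!catA /=.
  apply: swap_second => e ep nex; rewrite leqNgt; apply/negP => e1.
  have {}e1 : count_mem e u = 1.
    move: e1; rewrite -count_L /L def_p.
    have : 0 < count_mem e (map fst p2) by rewrite -has_count has_pred1.
    do 3![rewrite ?map_cat /= ?count_cat /=];
      rewrite [x == e]eq_sym (negbTE nex); clear; lia.
  have [h1 h2 _ _] := sep _ ep e1.
  exact: (second_order_agree uv (cu x) (cu y) x2 y2 e1 h1 h2 uxy vyx).
(* Here the first [y] precedes the first [x], so [second_order_agree] is applied to the identity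
   read from [v] to [u]. *)
have [p1 [p2 [p3 def_p]]] := H pL0.2 pL0.1.
have sep := separated _ _ _ _ _ _ def_p.
apply: derives_sym; rewrite def_p map_cat /= map_cat /= -!catA /= -!catA /=.
apply: swap_second => e ep nex; rewrite leqNgt; apply/negP => e1.
have {}e1 : count_mem e u = 1.
  move: e1; rewrite -count_L /L def_p.
  have : 0 < count_mem e (map fst p2) by rewrite -has_count has_pred1.
  do 3![rewrite ?map_cat /= ?count_cat /=];
    rewrite [y == e]eq_sym (negbTE nex); clear; lia.
have [_ _ h1 h2] := sep _ ep e1.
apply: (second_order_agree (theta_sym uv) _ _ _ _ _ h1 h2 vyx uxy);
  rewrite ?cuv //; exact: (core_derivesN uvN).
Qed.

Lemma filter_subst x w : filter (predC1 x) w =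
  subst (fun i => if i == x then [::] else [:: i]) w.
Proof.
elim: w => //= i w IH; rewrite /subst /= -/(subst _ _) -IH.
by case: (i == x).
Qed.

(** Induction on the size of [u]: a non-core letter is split off as a square on both sides, and
    [theta] survives its deletion. *)
Lemma theta_derivesMd u v : theta u v -> derivesMd u v.
Proof.
have [n] := ubnP (size u); elim: n u v => // n IH u v un uv.
have [cu|/existsNP[x ncx]] := pselect (forall x, core u x).
  exact: core_complete.
have ncy : ~ core v x.
  by move=> cv; apply: ncx; apply: core_derivesN cv; apply/derives_sym/theta_N.
apply: (derives_trans _ (extract_square ncx)).
apply: (derives_trans _ _ (derives_sym (extract_square ncy))).
apply: derives_cat; first exact: derives_refl.
apply: IH; last by rewrite !filter_subst; apply: theta_subst.
rewrite -ltnS; apply: leq_trans un; rewrite ltnS size_filter.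
have : 0 < count_mem x u.
  by rewrite lt0n; apply/eqP => e; apply: ncx; left; rewrite e.
rewrite -(count_predC (pred1 x) u) (@eq_count _ (predC1 x) (predC (pred1 x)))
  //; lia.
Qed.

End CompletenessMd.

(** * Isoterms of the join *)

Lemma tokens_from_cat pre u v :
  tokens_from pre (u ++ v) = tokens_from pre u ++ tokens_from (catrev u pre) v.
Proof. by elim: u pre => //= c u IH pre; rewrite IH. Qed.

Lemma tokens_from_const pre k w : uniq w ->
  {in w, forall a, count_mem a pre = k} ->
  tokens_from pre w = [seq (a, k) | a <- w].
Proof.
elim: w pre => //= c w IH pre /andP[cw uw] H; rewrite H ?mem_head //.
rewrite IH // => a aw /=; rewrite H ?inE ?aw ?orbT //.
by case: eqP cw => // ->; rewrite aw.
Qed.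

(* In F ++ S every letter of S is doubled and every other letter of F is
   simple. *)
Section TwoParts.
Variables F S : word.
Hypothesis uF : uniq F.
Hypothesis uS : uniq S.
Hypothesis SF : {subset S <= F}.
Let u := F ++ S.

Lemma count_two a : count_mem a u = (a \in F) + (a \in S).
Proof. by rewrite count_cat !count_uniq_mem. Qed.

Lemma tokens_two : tokens u = [seq (a, 0) | a <- F] ++ [seq (a, 1) | a <- S].
Proof.
rewrite /tokens tokens_from_cat; congr cat; first exact: tokens_from_const.
apply: tokens_from_const => // a aS; rewrite catrevE cats0 count_rev.
by rewrite count_uniq_mem // SF.
Qed.

Let utok := uniq_tokens u.

Lemma before_two00 a b : a \in F -> b \in F ->
  before (tokens u) (a, 0) (b, 0) = before F a b.
Proof.
move=> aF bF; rewrite tokens_two /before !index_cat !map_f //.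
by rewrite !index_map // => c d [].
Qed.

Lemma before_two11 a b : a \in S -> b \in S ->
  before (tokens u) (a, 1) (b, 1) = before S a b.
Proof.
move=> aS bS; rewrite tokens_two /before !index_cat.
have H c : (c, 1) \in [seq (a, 0) | a <- F] = false.
  by apply/negbTE/negP => /mapP[? _ []].
by rewrite !H ltn_add2l !index_map // => c d [].
Qed.

Lemma before_two01 a b : a \in F -> b \in S ->
  before (tokens u) (a, 0) (b, 1).
Proof.
move=> aF bS; move: utok; rewrite tokens_two => ut.
by apply: before_cat => //; apply: map_f.
Qed.

Definition separated_in (a b t : nat) : bool :=
  [&& t \in F, t \notin S, before F a t & before F t b].

Variables x y : nat.
Hypothesis xy : x != y.
Hypothesis sep2 : forall a b, a \in S -> b \in S -> before F a b ->
  (a, b) = (x, y) \/ exists t, separated_in a b t.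

Lemma adjacent_doubled l c d r : F = l ++ c :: d :: r -> c \in S -> d \in S ->
  (c, d) = (x, y).
Proof.
move=> eF cS dS.
have cd : before F c d.
  rewrite eF -cat_rcons before_cat ?mem_rcons ?mem_head //.
  by rewrite cat_rcons -eF.
case: (sep2 cS dS cd) => // -[t /and4P[tF tS ct td]].
have tr : t \in d :: r.
  by apply: (@before_mem_suffix _ l _ c); rewrite -?eF.
have tl : t \in rcons l c.
  by apply: (@before_mem_prefix _ _ r d); rewrite cat_rcons -eF.
move: uF; rewrite eF -cat_rcons cat_uniq => /and3P[_ /hasPn /(_ t tr)].
by rewrite /= tl.
Qed.

(** Every letter of [X ++ Y] recurs in [r], hence is doubled, and adjacent doubled letters in [F]
    can only be [x], [y]. So [X ++ Y] has at most two letters, and non-commutation makes [X] and [Y]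
    nonempty. *)
Lemma repeated_factor l X Y r : u = l ++ (X ++ Y) ++ r ->
  {subset X ++ Y <= r} -> X ++ Y <> Y ++ X -> X = [:: x] /\ Y = [:: y].
Proof.
move=> eu XYr ncomm; have XYS c : c \in X ++ Y -> c \in S.
  move=> cXY; have : 1 < count_mem c u.
    rewrite eu 2!count_cat.
    have : 0 < count_mem c (X ++ Y) by rewrite -has_count has_pred1.
    have : 0 < count_mem c r by rewrite -has_count has_pred1 XYr.
    lia.
  by rewrite count_two; case: (c \in S); case: (c \in F).
have pair l1 c d r1 : X ++ Y = l1 ++ c :: d :: r1 -> (c, d) = (x, y).
  move=> e; have [cXY dXY] : c \in X ++ Y /\ d \in X ++ Y.
    by rewrite e !mem_cat !inE !eqxx !orbT.
  pose Q := rcons (l ++ l1) c; pose P := rcons Q d.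
  have eP : P = (l ++ l1) ++ [:: c; d] by rewrite /P /Q -!cats1 -!catA.
  have eu' : F ++ S = P ++ (r1 ++ r).
    by rewrite eP; move: eu; rewrite /u e => ->; rewrite -!catA.
  (* Otherwise [d] would lie in the part [S] and again in [r], although [S] has no repetitions. *)
  have szF : size P <= size F.
    rewrite leqNgt; apply/negP => lt.
    have := congr1 (drop (size F)) eu'.
    rewrite drop_size_cat // drop_cat lt => eS.
    have dd : d \in drop (size F) P.
      by rewrite /P drop_rcons ?mem_rcons ?mem_head // -ltnS -(size_rcons Q d).
    move: uS; rewrite eS cat_uniq => /and3P[_ /hasPn /(_ d)].
    by rewrite mem_cat XYr // orbT => /(_ isT); rewrite /= dd.
  have eF : F = (l ++ l1) ++ c :: d :: drop (size P) F.
    have := congr1 (take (size P)) eu'.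
    rewrite (@take_size_cat _ _ P) // takel_cat // => et.
    by rewrite -{1}(cat_take_drop (size P) F) et eP -catA.
  by apply: adjacent_doubled eF _ _; apply: XYS.
have short c d e Z : X ++ Y <> [:: c, d, e & Z].
  move=> eZ; have [_ ey] := pair [::] _ _ _ eZ.
  by have [ex _] := pair [:: c] _ _ _ eZ; move: xy; rewrite -ex ey eqxx.
case: X Y ncomm pair short {eu XYr XYS} => [|c X] [|d Y]; rewrite ?cats0 //=.
move=> _ pair; case: X pair => [|c' X] pair short; last first.
  by case: X pair short => [|? ?] pair short; case: (short _ _ _ _ (erefl _)).
case: Y pair short => [|d' Y] pair short;
  last by case: (short _ _ _ _ (erefl _)).
by have [-> ->] := pair [::] _ _ _ (erefl _).
Qed.

Variables z c : nat.
Variable F' : word.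
Hypothesis eF' : F = rcons F' z.
Hypothesis zS : z \notin S.
Hypothesis xyS : x \in S /\ y \in S.
Hypothesis cS : [/\ c \in S, before S x c & before S c y].
Hypothesis bxy : before F x y.

(** The order of all pairs of tokens is forced. The simple letter [z] closing [F] makes all doubled
    letters core, so comparisons with simple letters are fixed by [N]. Separating simple letters
    then settle two first occurrences directly and two second ones by [second_order_agree]. For the
    unseparated pair, [before_first] handles the first occurrences, and [c] the second ones. *)
Lemma isoterm_two w : derivesN u w -> derivesMd u w -> w = u.
Proof.
move=> uN uMd.
have zF : z \in F by rewrite eF' mem_rcons mem_head.
have zlast a : a \in S -> before F a z.
  move=> aS; have := SF aS; rewrite eF' mem_rcons inE.
  case: (a =P z) => [e|_ /= aF']; first by move: zS; rewrite -e aS.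
  rewrite -cats1 before_cat //; first by rewrite cats1 -eF'.
  by rewrite mem_head.
have z1 : count_mem z u = 1 by rewrite count_two zF (negbTE zS).
have S2 a : a \in S -> count_mem a u = 2 by move=> aS; rewrite count_two aS SF.
have tokS a i : a \in S -> i < 2 -> (a, i) \in tokens u.
  by move=> aS i2; rewrite mem_tokens S2.
have corez a : a \in S -> proj [:: a; z] u = [:: 0; 1; 0].
  move=> aS; apply: proj_eq => //.
  - by rewrite /= inE andbT; apply: contraNneq zS => <-.
  - by rewrite /= S2 // z1.
  by rewrite /= (before_two00 (SF aS) zF) zlast // (before_two01 zF aS).
have coreu a : core u a.
  case: (boolP (a \in S)) => aS; first by right; exists z; apply: corez.
  by left; rewrite count_two (negbTE aS) addn0; case: (a \in F).
have ceq a : count_mem a w = count_mem a u by apply: core_count.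
have simple a t i : i < count_mem a u -> t \in F -> t \notin S ->
    before (tokens u) (a, i) (t, 0) = before (tokens w) (a, i) (t, 0) /\
    before (tokens u) (t, 0) (a, i) = before (tokens w) (t, 0) (a, i).
  move=> ai tF tS; apply: before_simple => //.
  by rewrite count_two tF (negbTE tS).
have simpleS a t i : a \in S -> t \in F -> t \notin S -> i < 2 ->
    before (tokens u) (a, i) (t, 0) = before (tokens w) (a, i) (t, 0) /\
    before (tokens u) (t, 0) (a, i) = before (tokens w) (t, 0) (a, i).
  by move=> aS tF tS i2; apply: simple => //; rewrite S2.
have nMd : ~ (derivesN sigma2.1 sigma2.2 /\ derivesMd sigma2.1 sigma2.2).
  case=> _ h; have := @closedbP [:: sigma2.1] basisMd _ _ isT h.
  by rewrite !inE eqxx.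
(* The identities common to [N] and the dual of [M] form an admissible theory, as the dual of [M]
   violates [sigma2]. *)
have agree := @second_order_agree (fun u v => derivesN u v /\ derivesMd u v)
  (fun r u v h => conj (derives_subst r h.1) (derives_subst r h.2))
  (fun u v h => h.1) nMd.
have second a b t : a \in S -> b \in S ->
    separated_in a b t || separated_in b a t -> before S a b ->
    before (tokens w) (a, 1) (b, 1).
  move=> aS bS abt Sab; have [aF bF] := (SF aS, SF bS).
  have uab : before (tokens u) (a, 1) (b, 1) by rewrite before_two11.
  have aw : (a, 1) \in tokens w by rewrite mem_tokens ceq S2.
  have bw : (b, 1) \in tokens w by rewrite mem_tokens ceq S2.
  case/orP: (before_total aw bw (before_neq uab)) => // wba; exfalso.
  case/orP: abt => /and4P[tF tS h1 h2].
    apply: (agree u w a b t) => //; rewrite ?(S2 a aS) ?(S2 b bS) //.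
    - by rewrite count_two tF (negbTE tS).
    - by rewrite before_two00.
    by rewrite before_two00.
  have cw d : core w d by apply: (core_derivesN uN).
  apply: (agree w u b a t) => //; rewrite ?ceq ?(S2 a aS) ?(S2 b bS) //.
  - by split; apply: derives_sym.
  - by rewrite count_two tF (negbTE tS).
  - by rewrite -(simpleS b t 0 bS tF tS isT).1 before_two00.
  by rewrite -(simpleS a t 0 aS tF tS isT).2 before_two00.
have third a b : a \in S -> b \in S -> (a, b) != (x, y) -> before S a b ->
    before (tokens w) (a, 1) (b, 1).
  move=> aS bS nab Sab; have [aF bF] := (SF aS, SF bS).
  have /orP[h|h] := before_total aF bF (before_neq Sab).
    case: (sep2 aS bS h) => [e|[t ht]]; first by rewrite e eqxx in nab.
    by apply: (second _ _ t) => //; rewrite ht.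
  case: (sep2 bS aS h) => [[eb ea]|[t ht]]; last first.
    by apply: (second _ _ t) => //; rewrite ht orbT.
  subst a b; case: cS => _ xc cy.
  by move: Sab; rewrite before_asym // (before_trans xc cy).
suff e : tokens u = tokens w by rewrite -(map_tokens w) -e map_tokens.
apply: before_eq; first exact: uniq_tokens.
  by apply: uniq_perm; rewrite ?uniq_tokens // => -[a i];
    rewrite !mem_tokens ceq.
move=> [a i] [b j] au bu uab.
have ai : i < count_mem a u by rewrite -mem_tokens.
have bj : j < count_mem b u by rewrite -mem_tokens.
have [aS|aS] := boolP (a \in S); last first.
  have aF : a \in F by move: ai; rewrite count_two (negbTE aS); case: (a \in F).
  have i0 : i = 0 by move: ai; rewrite count_two (negbTE aS) aF; case: (i).
  by subst i; rewrite -(simple b a j bj aF aS).2.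
have [bS|bS] := boolP (b \in S); last first.
  have bF : b \in F by move: bj; rewrite count_two (negbTE bS); case: (b \in F).
  have j0 : j = 0 by move: bj; rewrite count_two (negbTE bS) bF; case: (j).
  by subst j; rewrite -(simple a b i ai bF bS).1.
rewrite !S2 // in ai bj.
have zz d : d \in S -> before (tokens w) (d, 0) (z, 0) /\
    before (tokens w) (z, 0) (d, 1).
  move=> dS; rewrite -(simpleS d z 0 dS zF zS isT).1.
  rewrite -(simpleS d z 1 dS zF zS isT).2.
  by rewrite (before_two00 (SF dS) zF) zlast // before_two01.
case: i ai uab au => [|[|//]] _ uab au; case: j bj uab bu => [|[|//]] _ uab bu.
- rewrite before_two00 ?SF // in uab; case: (sep2 aS bS uab) => [[ea eb]|[t]].
    have [xS yS] := xyS; subst a b; apply: (@before_first u w uN x y z).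
    + by [].
    + by apply: contraNneq zS => <-.
    + by apply: contraNneq zS => <-.
    apply: proj_eq => //.
    + rewrite /= !inE negb_or xy andbT /=.
      by apply/andP; split; apply: contraNneq zS => <-.
    + by rewrite /= (S2 x xS) (S2 y yS) z1.
    case: cS => _ xc cy.
    rewrite /= (before_two00 (SF xS) (SF yS)) bxy.
    rewrite (before_two00 (SF yS) zF) zlast // (before_two01 zF xS).
    by rewrite (before_two11 xS yS) (before_trans xc cy).
  case/and4P => tF tS h1 h2; apply: (@before_trans _ _ (t, 0)).
    by rewrite -(simpleS a t 0 aS tF tS isT).1 before_two00 // SF.
  by rewrite -(simpleS b t 0 bS tF tS isT).2 before_two00 // SF.
- exact: before_trans (zz a aS).1 (zz b bS).2.
- by move: uab; rewrite before_asym // before_two01 ?SF.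
rewrite before_two11 // in uab.
have [[ea eb]|nab] := eqVneq (a, b) (x, y); last exact: third.
(* The second occurrences of [x] and [y] are compared through that of [c], which lies between
   them. *)
subst a b; case: cS => cS' xc cy; apply: (@before_trans _ _ (c, 1)).
  by apply: third => //; apply: contraTneq cy => -[->]; rewrite /before ltnn.
by apply: third => //; apply: contraTneq xc => -[->]; rewrite /before ltnn.
Qed.

End TwoParts.

(* The index i stands for the doubled letter 2i, and 2i+1 is a simple letter. *)
Definition spaced (o : seq nat) : word :=
  flatten [seq [:: i.*2; i.*2.+1] | i <- o].
Definition doubles (s : seq nat) : word := [seq i.*2 | i <- s].

(** Only the first occurrences of the letters [0] and [2] are governed by [x] and [y], so
    [osc_word 2 0] arises from [osc_word 0 2] by swapping one factor. *)
Definition osc_word (x y : nat) (p q s : seq nat) : word :=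
  spaced p ++ [:: x; y; 1] ++ spaced q ++ 0 :: doubles s ++ [:: 2].

Lemma mem_spaced i o : (i \in spaced o) = (i./2 \in o).
Proof.
elim: o => //= j o IH; rewrite /spaced /= -/(spaced o) !inE IH orbA.
by congr orb; lia.
Qed.

Lemma mem_doubles i s : (i \in doubles s) = ~~ odd i && (i./2 \in s).
Proof. by elim: s => [|j s IH] /=; rewrite ?andbF // !inE IH;
  case: (_ \in s); lia. Qed.

Lemma spaced_cat o o' : spaced (o ++ o') = spaced o ++ spaced o'.
Proof. by rewrite /spaced map_cat flatten_cat. Qed.

Lemma uniq_spaced o : uniq o -> uniq (spaced o).
Proof.
elim: o => //= i o IH /andP[io uo]; rewrite /spaced /= -/(spaced o) IH //.
by rewrite !inE !mem_spaced /= uphalf_double doubleK io; lia.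
Qed.

Lemma uniq_doubles s : uniq s -> uniq (doubles s).
Proof. by move=> us; rewrite map_inj_uniq //; apply: double_inj. Qed.

(** * Isoterm property and matchings of [osc_word] *)

Section Osc.
Variables p q s : seq nat.
Hypothesis upq : uniq (p ++ q).
Hypothesis spq : perm_eq s (p ++ q).
Hypothesis pq2 : all (leq 2) (p ++ q).
Hypothesis q0 : q <> [::].

Let F := spaced p ++ [:: 0; 2; 1] ++ spaced q.
Let S := 0 :: doubles s ++ [:: 2].

Lemma osc_wordE : osc_word 0 2 p q s = F ++ S.
Proof. by rewrite /osc_word /F /S -!catA. Qed.

Lemma small_pq i : i < 2 -> (i \in p) = false /\ (i \in q) = false.
Proof.
move=> i2; suff : i \notin p ++ q by rewrite mem_cat =>
  /norP[/negbTE -> /negbTE ->].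
by apply/negP => /(allP pq2) /=; lia.
Qed.

Lemma mem_firsts i : (i \in F) = [|| i./2 \in p, i <= 2 | i./2 \in q].
Proof.
rewrite !mem_cat !inE !mem_spaced; congr (_ || _); rewrite !orbA;
  congr (_ || _).
by lia.
Qed.

Lemma mem_seconds i : (i \in S) = ~~ odd i && [|| i./2 \in p,
  i <= 2 | i./2 \in q].
Proof.
rewrite inE mem_cat inE mem_doubles (perm_mem spq) mem_cat.
by case: (i./2 \in p); case: (i./2 \in q); lia.
Qed.

Lemma uniq_firsts : uniq F.
Proof.
have e : perm_eq F ([:: 0; 2; 1] ++ spaced (p ++ q)).
  by rewrite /F spaced_cat perm_catCA perm_cat2l perm_refl.
rewrite (perm_uniq e) cat_uniq uniq_spaced // andbT; apply/hasPn => i.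
rewrite mem_spaced => /(allP pq2) /= i2.
change (i \notin [:: 0; 2; 1]); rewrite !inE; lia.
Qed.

Lemma uniq_seconds : uniq S.
Proof.
have us : uniq s by rewrite (perm_uniq spq).
rewrite /S cats1 cons_uniq rcons_uniq mem_rcons inE uniq_doubles //
  !mem_doubles.
have [[p0 q0'] [p1 q1]] := (@small_pq 0 isT, @small_pq 1 isT).
by rewrite !(perm_mem spq) !mem_cat /= p0 q0' p1 q1.
Qed.

Lemma seconds_firsts : {subset S <= F}.
Proof. by move=> i; rewrite mem_seconds mem_firsts => /andP[]. Qed.

Lemma before_next l a m t r b : F = l ++ a :: m ++ t :: r ->
  b \notin rcons m t -> before F a b -> b \in F ->
  before F a t /\ before F t b.
Proof.
move=> eF bt ab bF; have uF := uniq_firsts.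
have : b \in m ++ t :: r.
  by apply: (@before_mem_suffix _ l _ a); rewrite -?eF.
rewrite -cat_rcons mem_cat (negbTE bt) /= => br; split.
  rewrite eF -cat_rcons before_cat //.
  - by rewrite cat_rcons -eF.
  - by rewrite mem_rcons mem_head.
  by rewrite mem_cat mem_head orbT.
rewrite eF -cat_cons -cat_rcons catA before_cat //.
  by rewrite -catA cat_rcons -eF.
by rewrite mem_cat mem_rcons mem_head orbT.
Qed.

Lemma spaced_split i o : i \in o ->
  exists l r, spaced o = l ++ i.*2 :: i.*2.+1 :: r.
Proof.
case/splitPr => o1 o2; exists (spaced o1), (spaced o2).
by rewrite spaced_cat.
Qed.

Lemma separated_firsts a b : a \in S -> b \in S -> before F a b ->
  (a, b) = (0, 2) \/ exists t, separated_in F S a b t.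
Proof.
move=> aS bS ab; have bF := seconds_firsts bS.
(* The block [m] between [a] and the next simple letter is empty, except that it is [[:: 2]] for
   [a = 0]. *)
suff [e|[m [t [l [r [eF bm ot]]]]]] : (a, b) = (0, 2) \/
    exists m t l r, [/\ F = l ++ a :: m ++ t :: r, b \notin m & odd t].
- by left.
- right; exists t; have tF : t \in F by rewrite eF mem_cat inE mem_cat !inE
  eqxx !orbT.
  have bt : b \notin rcons m t.
    rewrite mem_rcons inE (negbTE bm) orbF.
    by apply: contraTneq bS => ->; rewrite mem_seconds ot.
  have [h1 h2] := before_next eF bt ab bF.
  by rewrite /separated_in tF h1 h2 mem_seconds ot.
have := aS; rewrite mem_seconds => /andP[ea /or3P[ap|a2|aq]].
- right; have [l [r e]] := spaced_split ap.
  exists [::], a.+1, l, (r ++ [:: 0; 2; 1] ++ spaced q); split=> //=.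
  by rewrite /F e -catA /= even_halfK.
- have [a0|a0] : a = 0 \/ a = 2 by lia.
    have [b2|b2] := eqVneq b 2; [by left; rewrite a0 b2|right].
    by exists [:: 2], 1, (spaced p), (spaced q); rewrite inE a0 b2.
  by right; exists [::], 1, (spaced p ++ [:: 0]), (spaced q); rewrite a0 -catA.
right; have [l [r e]] := spaced_split aq.
exists [::], a.+1, (spaced p ++ [:: 0; 2; 1] ++ l), r; split=> //=.
by rewrite /F e -!catA /= even_halfK.
Qed.

Lemma osc_isoterm w : derivesN (osc_word 0 2 p q s) w ->
  derivesMd (osc_word 0 2 p q s) w -> w = osc_word 0 2 p q s.
Proof.
have [q' [k eq]] : exists q' k, q = rcons q' k.
  by case/lastP: (q) q0 => // q' k _; exists q', k.
have : k \in s by rewrite (perm_mem spq) eq mem_cat mem_rcons mem_head orbT.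
case es: s => [|h s'] // _; rewrite -es osc_wordE.
have eS : S = 0 :: h.*2 :: doubles s' ++ [:: 2] by rewrite /S es.
have hS : h.*2 \in S by rewrite eS !inE eqxx orbT.
(* The last simple letter of [F] follows the last index [k] of [q]; the first letter of [doubles s]
   lies between the second occurrences of [0] and [2]. *)
apply: (@isoterm_two F S uniq_firsts uniq_seconds seconds_firsts 0 2 isT
  separated_firsts k.*2.+1 h.*2
  (spaced p ++ [:: 0; 2; 1] ++ spaced q' ++ [:: k.*2])).
- by rewrite /F eq -cats1 spaced_cat -cats1 -!catA.
- by rewrite mem_seconds /= negbK odd_double.
- by rewrite !mem_seconds /= !orbT.
- split=> //.
    have e : S = [:: 0] ++ (h.*2 :: doubles s' ++ [:: 2]) by rewrite eS.
    by rewrite e before_cat -?e ?uniq_seconds ?mem_head.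
  have e : S = [:: 0; h.*2] ++ (doubles s' ++ [:: 2]) by rewrite eS.
  by rewrite e before_cat -?e ?uniq_seconds // ?mem_cat ?mem_head ?orbT //
    !inE eqxx orbT.
have e : F = (spaced p ++ [:: 0]) ++ [:: 2; 1] ++ spaced q by rewrite -catA.
rewrite e before_cat ?mem_head -?e ?uniq_firsts //.
by rewrite mem_cat mem_head orbT.
Qed.

Lemma split_eq (T : eqType) (c : T) l1 l2 r1 r2 :
  l1 ++ c :: r1 = l2 ++ c :: r2 -> c \notin l1 -> c \notin l2 ->
  l1 = l2 /\ r1 = r2.
Proof.
elim: l1 l2 => [|d l1 IH] [|e l2] //=; first by case.
- by case=> -> _; rewrite mem_head.
- by case=> -> _; rewrite mem_head.
case=> -> /IH{}IH; rewrite !inE !negb_or => /andP[_ h1] /andP[_ h2].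
by have [-> ->] := IH h1 h2.
Qed.

Lemma subst_cons r c w : subst r (c :: w) = r c ++ subst r w.
Proof. by []. Qed.

Lemma count_osc i : i \in [:: 0; 2] -> count_mem i (osc_word 0 2 p q s) = 2.
Proof.
rewrite osc_wordE count_two; try exact: uniq_firsts; try exact: uniq_seconds.
by rewrite mem_firsts mem_seconds !inE => /orP[]/eqP -> /=; rewrite !orbT.
Qed.

Section Match.
Variables (p' q' s' a b : seq nat) (r : nat -> word).
Hypothesis ncomm : r 0 ++ r 2 <> r 2 ++ r 0.

(** By [repeated_factor], [r 2] would be the letter [0] and [r 0] the letter [2]. As the left-hand
    side ends in [2], so would [b], giving a third occurrence of [2]. *)
Lemma osc_match_swapped :
  osc_word 0 2 p q s <> a ++ subst r (osc_word 2 0 p' q' s') ++ b.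
Proof.
rewrite /(osc_word 2) !(subst_cat, subst_cons) cats0 => e.
have [] := @repeated_factor F S uniq_firsts uniq_seconds 0 2 isT
  separated_firsts (a ++ subst r (spaced p'))
  (r 2) (r 0) (r 1 ++ subst r (spaced q') ++ r 0 ++ subst r (doubles s') ++ r
    2 ++ b).
- by rewrite -osc_wordE e -!catA.
- by move=> c; rewrite !mem_cat => /orP[] ->; rewrite !orbT.
- by move/esym.
move=> r2 r0; have := count_osc (isT : 2 \in [:: 0; 2]).
have : last 0 (osc_word 0 2 p q s) = 2 by rewrite osc_wordE last_cat /=
  last_cat.
rewrite e r2 r0 !last_cat /=; case/lastP: b => [//|b' c];
  rewrite last_rcons => ->.
by do 4![rewrite ?count_cat /=]; rewrite -cats1 count_cat /=; lia.
Qed.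

(** By [repeated_factor], [r] fixes [0] and [2]; counting shows that no other part of the image
    contains these letters in a way that could blur the cuts, so both words split at them into
    matching pieces. *)
Lemma osc_match :
  osc_word 0 2 p q s = a ++ subst r (osc_word 0 2 p' q' s') ++ b ->
  [/\ a ++ subst r (spaced p') = spaced p,
      r 1 ++ subst r (spaced q') = 1 :: spaced q
    & subst r (doubles s') = doubles s].
Proof.
rewrite /(osc_word 0 2 p') !(subst_cat, subst_cons) cats0 => e.
have [] := @repeated_factor F S uniq_firsts uniq_seconds 0 2 isT
  separated_firsts (a ++ subst r (spaced p'))
  (r 0) (r 2) (r 1 ++ subst r (spaced q') ++ r 0 ++ subst r (doubles s') ++ r
    2 ++ b).
- by rewrite -osc_wordE e -!catA.
- by move=> c; rewrite !mem_cat => /orP[] ->; rewrite !orbT.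
- by [].
move=> r0 r2; have := count_osc (isT : 2 \in [:: 0; 2]);
  have := count_osc (isT : 0 \in [:: 0; 2]).
rewrite {1 2}e r0 r2; do 4![rewrite ?count_cat /=] => c0 c2.
have [a0 ap0 r10 aq0] : [/\ count_mem 0 a = 0,
  count_mem 0 (subst r (spaced p')) = 0,
    count_mem 0 (r 1) = 0 & count_mem 0 (subst r (spaced q')) = 0].
  by move: c0; do 6!move: (count_mem 0 _) => ?; split; lia.
have s2 : count_mem 2 (subst r (doubles s')) = 0.
  by move: c2; do 6!move: (count_mem 2 _) => ?; lia.
have [[p0 q0'] [p1 q1]] := (@small_pq 0 isT, @small_pq 1 isT).
have ns i : i < 2 -> i.*2 \notin spaced p /\ i.*2 \notin spaced q.
  by move=> i2; rewrite !mem_spaced doubleK !(small_pq i2).1 !(small_pq i2).2.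
have nd : 2 \notin doubles s.
  by rewrite mem_doubles (perm_mem spq) mem_cat p1 q1.
move: e; rewrite r0 r2 /osc_word -!catA /=.
rewrite [a ++ _]catA => /split_eq[].
- exact: (ns 0 isT).1.
- by apply/count_memPn; rewrite count_cat a0 ap0.
move=> ep [] /=; rewrite -cat_cons catA => /split_eq[].
- by rewrite inE (negbTE (ns 0 isT).2).
- by apply/count_memPn; rewrite count_cat r10 aq0.
move=> eq /split_eq[] //.
by apply/count_memPn.
Qed.

End Match.
End Osc.

(** * The antichain *)

(* Sorting by this key puts 2 right after 5, and 3 right before 2n+4.  The pairs
   of indices >= 4 that it inverts are the edges of the path
   5 - 4 - 7 - 6 - ... - (2n+5) - (2n+4). *)
Definition osc_key (n i : nat) : nat :=
  if i == 3 then n.*2 + 3 else if odd i then i - 4 else i.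

Definition osc_first (n : nat) : seq nat := iota 4 n.*2.+2.
Definition osc_second (n : nat) : seq nat :=
  sort (relpre (osc_key n) leq) (osc_first n ++ [:: 2; 3]).

Definition osc_l (n : nat) : word :=
  osc_word 0 2 (osc_first n) [:: 2; 3] (osc_second n).
Definition osc_r (n : nat) : word :=
  osc_word 2 0 (osc_first n) [:: 2; 3] (osc_second n).

Lemma mem_osc_first n i : (i \in osc_first n) = (4 <= i <= n.*2 + 5).
Proof. by rewrite mem_iota; lia. Qed.

Lemma osc_uniq n : uniq (osc_first n ++ [:: 2; 3]).
Proof. by rewrite cat_uniq iota_uniq /= !mem_iota. Qed.

Lemma osc_perm n : perm_eq (osc_second n) (osc_first n ++ [:: 2; 3]).
Proof. by rewrite perm_sort. Qed.

Lemma osc_ge2 n : all (leq 2) (osc_first n ++ [:: 2; 3]).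
Proof. by rewrite all_cat /= andbT; apply/allP => i; rewrite mem_iota /=;
  lia. Qed.

Lemma mem_osc_second n i : (i \in osc_second n) = (2 <= i <= n.*2 + 5).
Proof. by rewrite (perm_mem (osc_perm n)) mem_cat mem_osc_first !inE; lia. Qed.

Lemma osc_key_inj n : {in osc_second n &, injective (osc_key n)}.
Proof.
move=> i j; rewrite !mem_osc_second /osc_key.
by do ![case: ifP]; lia.
Qed.

Lemma subseq2_total (T : eqType) (i j : T) w : i \in w -> j \in w -> i != j ->
  subseq [:: i; j] w || subseq [:: j; i] w.
Proof.
move=> iw jw ij; case/splitPr: iw jw => w1 w2.
rewrite mem_cat inE eq_sym (negbTE ij) /= => /orP[jw|jw]; apply/orP;
  [right|left].
  by rewrite -[[:: j; i]]/([:: j] ++ [:: i]) cat_subseq // sub1seq // mem_head.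
by apply: subseq_trans (suffix_subseq w1 _); rewrite /= eqxx sub1seq.
Qed.

Lemma sorted_second n : sorted (relpre (osc_key n) leq) (osc_second n).
Proof. by apply: sort_sorted => i j; apply: leq_total. Qed.

Lemma subseq_second n i j : subseq [:: i; j] (osc_second n) ->
  osc_key n i <= osc_key n j.
Proof.
have tr : transitive (relpre (osc_key n) leq) by move=> a b c; apply: leq_trans.
by move/(subseq_sorted tr) => /(_ (sorted_second n)); rewrite /= andbT.
Qed.

Lemma second_subseq n i j : i \in osc_second n -> j \in osc_second n ->
  osc_key n i < osc_key n j -> subseq [:: i; j] (osc_second n).
Proof.
move=> iS jS ij; have nij : i != j by apply: contraTneq ij => ->; rewrite ltnn.
case/orP: (subseq2_total iS jS nij) => // /subseq_second; lia.
Qed.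

Lemma subseq_subst r u v : subseq u v -> subseq (subst r u) (subst r v).
Proof.
elim: v u => [|j v IH] [|i u] //=; first by rewrite sub0seq.
case: eqP => [->|_] h; first by rewrite !subst_cons cat_subseq ?IH.
by rewrite subst_cons; apply: subseq_trans (IH _ h) (suffix_subseq _ _).
Qed.

Lemma subseq_doubles i j s : subseq [:: i.*2;
  j.*2] (doubles s) = subseq [:: i; j] s.
Proof.
apply/idP/idP => [h|/(map_subseq double)] //.
have e t : map half (doubles t) = t.
  by rewrite -map_comp map_id_in // => k _; apply: doubleK.
by have := map_subseq half h; rewrite e -[[:: i.*2; j.*2]]/(doubles [:: i;
  j]) e.
Qed.

Lemma sorted_spaced n : sorted ltn (spaced (osc_first n)).
Proof.
have -> : spaced (osc_first n) = iota 8 (n.*2.+2).*2.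
  rewrite /osc_first -[8]/(4.*2); elim: (n.*2.+2) 4 => //= k IH a.
  by rewrite /spaced /= -/(spaced _) IH doubleS.
exact: iota_ltn_sorted.
Qed.

Section Chain.
Variables n m : nat.
Variable r : nat -> word.
Hypothesis second_eq : subst r (doubles (osc_second m)) = doubles (osc_second
  n).
Variable a : word.
Hypothesis first_eq : a ++ subst r (spaced (osc_first m)) = spaced (osc_first
  n).
Hypothesis rest_eq : r 1 ++ subst r (spaced [:: 2; 3]) = 1 :: spaced [:: 2; 3].

(** The partial map of indices induced by [r]; it is undefined where a letter is erased. *)
Let C i j := r i.*2 = [:: j.*2].

(** The image consists of even letters, as it lies in a word [doubles _], and it is also a factor of
    a word without adjacent even letters. *)
Lemma short_image i : i \in osc_second m -> size (r i.*2) <= 1.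
Proof.
move=> iS; have sub w : subst r w = flatten (map r w) by [].
have even_r c : c \in r i.*2 -> ~~ odd c.
  move=> cr; have : c \in doubles (osc_second n).
    rewrite -second_eq; apply/flattenP; exists (r i.*2) => //.
    by apply/map_f; rewrite mem_doubles odd_double doubleK.
  by rewrite mem_doubles => /andP[].
have no_pair o : forall l c d t, spaced o = l ++ c :: d :: t -> odd c || odd d.
  elim: o => [|k o IH] [|e [|f l]] c d t //=; rewrite /spaced /= -/(spaced o).
  - by case=> _ <- _; rewrite /= odd_double orbT.
  - by case=> _ <- _; rewrite /= odd_double.
  by case=> _ _ /IH.
have no_pair1 l c d t : 1 :: spaced [:: 2;
  3] = l ++ c :: d :: t -> odd c || odd d.
  by case: l => [|e l]; [case=> <- | case=> _ /no_pair].
have factor w : i.*2 \in w -> exists l t, subst r w = l ++ r i.*2 ++ t.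
  by case/splitPr => w1 w2; rewrite subst_cat subst_cons;
    exists (subst r w1), (subst r w2).
suff [l [t e]] : exists l t, spaced (osc_first n) = l ++ r i.*2 ++ t \/
    1 :: spaced [:: 2; 3] = l ++ r i.*2 ++ t.
  case: (r i.*2) e even_r => [|c [|d w]] //= e even_r.
  have : odd c || odd d by case: e => [/no_pair|/no_pair1].
  by rewrite !(negbTE (even_r _ _)) // !inE eqxx ?orbT.
move: iS; rewrite (perm_mem (osc_perm m)) mem_cat => /orP[ip|iq].
  have [|l [t e]] := factor (spaced (osc_first m));
    first by rewrite mem_spaced doubleK.
  by exists (a ++ l), t; left; rewrite -first_eq e catA.
have [|l [t e]] := factor (spaced [:: 2; 3]);
  first by rewrite mem_spaced doubleK.
by exists (r 1 ++ l), t; right; rewrite -rest_eq e catA.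
Qed.

Lemma chain_ex j : j \in osc_second n ->
  exists i, [/\ i \in osc_second m,
    C i j & (i \in osc_first m) = (j \in osc_first n)].
Proof.
move=> jS; have : j.*2 \in doubles (osc_second n) by rewrite mem_doubles
  odd_double doubleK.
rewrite -second_eq => /flattenP[w /mapP[c]];
  rewrite mem_doubles => /andP[ec cS] -> jr.
have ec2 : c = c./2.*2 by rewrite even_halfK.
move: jr; rewrite {1}ec2 => jr; exists c./2.
have eC : C c./2 j.
  move: (short_image cS) jr; rewrite /C; case: (r _) => [|d [|//]] // _.
  by rewrite inE => /eqP ->.
split=> //; have mem_im o : c./2 \in o -> j.*2 \in subst r (spaced o).
  move=> co; apply/flattenP; exists (r c./2.*2); last by rewrite eC inE.
  by apply: map_f; rewrite mem_spaced doubleK.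
case: (boolP (c./2 \in osc_first m)) => ci.
  have : j.*2 \in spaced (osc_first n) by rewrite -first_eq mem_cat mem_im
    ?orbT.
  by rewrite mem_spaced doubleK => ->.
have cq : c./2 \in [:: 2; 3].
  by move: cS; rewrite (perm_mem (osc_perm m)) mem_cat (negbTE ci).
have : j.*2 \in 1 :: spaced [:: 2; 3] by rewrite -rest_eq mem_cat mem_im ?orbT.
rewrite inE mem_spaced doubleK mem_osc_first !inE; lia.
Qed.

(** Substitution preserves subsequences, so the opposite order of the preimages would carry over to
    the images. *)
Lemma chain_second i j i' j' : C i j -> C i' j' -> i \in osc_second m ->
  i' \in osc_second m -> osc_key n j < osc_key n j' ->
  osc_key m i <= osc_key m i'.
Proof.
move=> e e' iS iS' jj; rewrite leqNgt; apply/negP => /(second_subseq iS' iS).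
rewrite -subseq_doubles => /(subseq_subst r).
by rewrite second_eq !subst_cons e e' subseq_doubles => /subseq_second; lia.
Qed.

Lemma chain_first i j i' j' : C i j -> C i' j' -> i \in osc_first m ->
  i' \in osc_first m -> j < j' -> i < i'.
Proof.
move=> e e' iP iP' jj; rewrite ltnNge leq_eqVlt; apply/negP => /orP[/eqP ii|ii].
  by move: e'; rewrite /C ii e => -[]; lia.
have : subseq [:: i'; i] (osc_first m).
  have nii : i' != i by lia.
  case/orP: (subseq2_total iP' iP nii) => // /(subseq_sorted ltn_trans).
  by move=> /(_ (iota_ltn_sorted _ _)) /=; lia.
move=> sub; have : subseq [:: i'.*2; i.*2] (spaced (osc_first m)).
  have := subseq_subst (fun k => [:: k.*2; k.*2.+1]) sub.
  apply: subseq_trans; rewrite /= eqxx.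
  by case: eqP => [|_]; [lia | rewrite eqxx].
move/(subseq_subst r); rewrite !subst_cons e e' /= => h.
have : subseq [:: j'.*2; j.*2] (spaced (osc_first n)).
  by rewrite -first_eq; apply: subseq_trans h (suffix_subseq _ _).
by move/(subseq_sorted ltn_trans)/(_ (sorted_spaced n)) => /=; lia.
Qed.

Lemma chain_fun i j j' : C i j -> C i j' -> j = j'.
Proof. by rewrite /C => -> []; lia. Qed.

(* The embedding fixes 2 and 3, hence the start 5 of the path, and then each
   next vertex, as the only neighbour of the previous one that is still free;
   the end 2n+4 must be the end 2m+4. *)
Lemma chain_eq : n = m.
Proof.
have mS : _ := mem_osc_second; have mP := mem_osc_first.
have C23 : C 2 2 /\ C 3 3.
  have [|i [iS iC ip]] := @chain_ex 2; first by rewrite mS; lia.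
  have [|i' [iS' iC' ip']] := @chain_ex 3; first by rewrite mS; lia.
  have ii : i <> i' by move=> e; subst i'; have := chain_fun iC iC'.
  have := chain_second iC iC' iS iS'; rewrite /osc_key /=.
  rewrite !mP in ip ip'; rewrite !mS in iS iS'.
  have [e|e] : i = 2 \/ i = 3 by lia.
    have e' : i' = 3 by lia.
    by subst i i'; split.
  have e' : i' = 2 by lia.
  by subst i i' => /= h; exfalso; lia.
have exP j : 4 <= j <= n.*2 + 5 -> exists i, [/\ i \in osc_first m,
  i \in osc_second m & C i j].
  move=> jn; have [|i [iS iC ip]] := @chain_ex j; first by rewrite mS; lia.
  by exists i; rewrite ip mP jn.
have S2 : 2 \in osc_second m by rewrite mS; lia.
have S3 : 3 \in osc_second m by rewrite mS; lia.
have lt_key i i' j j' : C i j -> C i' j' -> i \in osc_second m ->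
    i' \in osc_second m -> osc_key n j < osc_key n j' -> osc_key m i <
      osc_key m i'.
  move=> e e' iS iS' jj; have := chain_second e e' iS iS' jj.
  rewrite leq_eqVlt => /orP[/eqP/(osc_key_inj iS iS') ii|//].
  by subst i'; move: jj; rewrite (chain_fun e e') ltnn.
have key3 k : osc_key k 3 = k.*2 + 3 by [].
have key2 k : osc_key k 2 = 2 by [].
have keyo k i : i != 3 -> odd i -> osc_key k i = i - 4 by rewrite /osc_key =>
  /negbTE -> ->.
have keye k i : ~~ odd i -> osc_key k i = i.
  by move=> oi; rewrite /osc_key (negbTE oi); case: eqP oi => // ->.
have key_alt k i : 4 <= i -> ~~ odd i /\ osc_key k i = i \/ odd i /\ osc_key
  k i = i - 4.
  move=> i4; case: (boolP (odd i)) => oi; last by left; split=> //; apply: keye.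
  by right; split=> //; apply: keyo => //; lia.
pose fixed c := C c c /\ c <= m.*2 + 5.
have preimage c : 4 <= c <= n.*2 + 5 -> exists i,
    [/\ i \in osc_first m, i \in osc_second m, C i c,
      4 <= i <= m.*2 + 5 & (~~ odd i /\
    osc_key m i = i \/ odd i /\ osc_key m i = i - 4)].
  move=> /exP[i [ip iS iC]]; exists i; split=> //; first by rewrite -mP.
  by apply: key_alt; move: ip; rewrite mP => /andP[].
have fix_in c : 4 <= c -> fixed c -> [/\ C c c,
  c \in osc_first m & c \in osc_second m].
  by move=> c4 [cC cm]; split=> //; rewrite ?mP ?mS; lia.
have f5 : fixed 5.
  have [|i [ip iS iC im ki]] := preimage 5; first by lia.
  (* Among the indices from 4 on, only 5 has a key below 2. *)
  have := lt_key _ _ _ _ iC C23.1 iS S2 isT; rewrite key2 => i2.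
  have e : i = 5 by lia.
  by subst i; split=> //; case/andP: im.
have f4 : fixed 4.
  have [|i [ip iS iC im ki]] := preimage 4; first by lia.
  have [C5 p5 _] := fix_in 5 isT f5.
  have i5 := chain_first iC C5 ip p5 isT.
  have e : i = 4 by lia.
  by subst i; split=> //; case/andP: im.
have fixed_all k : k <= n -> fixed (k.*2 + 4) /\ fixed (k.*2 + 5).
  elim: k => [//|k IH] kn; have [fe fo] := IH (ltnW kn).
  have [|Ce pe se] := fix_in (k.*2 + 4) _ fe; first by rewrite leq_addl.
  have [|Co po so] := fix_in (k.*2 + 5) _ fo;
    first by rewrite (leq_trans _ (leq_addl _ _)).
  have key4 l : osc_key l (k.*2 + 4) = k.*2 + 4 by apply: keye; clear; lia.
  have key6 l : osc_key l (k.*2 + 6) = k.*2 + 6 by apply: keye; clear; lia.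
  have key7 l : osc_key l (k.*2 + 7) = k.*2 + 3.
    by rewrite keyo; clear; lia.
  (* The preimage exceeds [2k+4] while its key is below [2k+4]: only [2k+5] and [2k+7] qualify, and
     the first is taken. *)
  have fo' : fixed (k.*2 + 7).
    have [|i [ip iS iC im ki]] := preimage (k.*2 + 7); first by clear -kn; lia.
    have i1 : k.*2 + 4 < i by apply: (chain_first Ce iC pe ip);
      rewrite ltn_add2l.
    have := lt_key _ _ _ _ iC Ce iS se;
      rewrite key7 !key4 ltn_add2l => /(_ isT) i2.
    have i3 : i <> k.*2 + 5.
      move=> e; subst i; have := chain_fun iC Co; clear; lia.
    have e : i = k.*2 + 7 by clear -i1 i2 i3 ki; lia.
    by subst i; split=> //; case/andP: im.
  have [|Co' po' so'] := fix_in (k.*2 + 7) _ fo'; first by clear; lia.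
  (* The preimage is below [2k+7] while its key exceeds [2k+3]: only [2k+4] and [2k+6] qualify, and
     the first is taken. *)
  have fe' : fixed (k.*2 + 6).
    have [|i [ip iS iC im ki]] := preimage (k.*2 + 6); first by clear -kn; lia.
    have i1 : i < k.*2 + 7 by apply: (chain_first iC Co' ip po');
      rewrite ltn_add2l.
    have := lt_key _ _ _ _ Co' iC so' iS;
      rewrite !key7 key6 ltn_add2l => /(_ isT) i2.
    have i3 : i <> k.*2 + 4.
      move=> e; subst i; have := chain_fun iC Ce; clear; lia.
    have e : i = k.*2 + 6 by clear -i1 i2 i3 ki im; lia.
    by subst i; split=> //; case/andP: im.
  by rewrite doubleS !addSnnS.
have [fe _] := fixed_all n (leqnn n).
have [|Ce _ se] := fix_in (n.*2 + 4) _ fe; first by lia.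
(* This says [2m+3 < 2n+4], so [m <= n]; the bound [2n+4 <= 2m+5] in [fixed] gives [n <= m]. *)
have : osc_key m 3 < osc_key m (n.*2 + 4).
  by apply: (lt_key _ _ _ _ C23.2 Ce S3 se); rewrite key3 keye; lia.
rewrite key3 keye; last by lia.
case: fe => _; lia.
Qed.
End Chain.

(** * The interval *)

Lemma osc_lr_neq n : osc_l n <> osc_r n.
Proof.
by rewrite /osc_l /osc_r /osc_word => /eqP; rewrite eqseq_cat // eqxx.
Qed.

Lemma subst_osc_comm r m : r 0 ++ r 2 = r 2 ++ r 0 ->
  subst r (osc_l m) = subst r (osc_r m).
Proof.
move=> c; have e : subst r [:: 0; 2; 1] = subst r [:: 2; 0; 1].
  by rewrite !subst_cons !catA c.
by rewrite /osc_l /osc_r /osc_word !subst_cat e.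
Qed.

(** If [r 0] and [r 2] commute, the step changes nothing; otherwise [osc_match] yields an embedding,
    and [chain_eq] gives [n = m]. *)
Lemma osc_step_l n m a b r : n <> m -> osc_l n = a ++ subst r (osc_l m) ++ b ->
  osc_l n = a ++ subst r (osc_r m) ++ b.
Proof.
move=> nm; have [/subst_osc_comm -> //|ncomm] := pselect (r 0 ++ r 2 = r 2 ++
  r 0).
have q0 : [:: 2; 3] <> [::] by [].
move/(osc_match (osc_uniq n) (osc_perm n) (osc_ge2 n) ncomm).
by case=> h1 h2 h3; case: nm; apply: chain_eq h3 _ h1 h2.
Qed.

Lemma osc_step_r n m a b r : osc_l n = a ++ subst r (osc_r m) ++ b ->
  osc_l n = a ++ subst r (osc_l m) ++ b.
Proof.
have [/subst_osc_comm -> //|ncomm] := pselect (r 0 ++ r 2 = r 2 ++ r 0).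
by move/(osc_match_swapped (osc_uniq n) (osc_perm n) (osc_ge2 n) ncomm).
Qed.

Lemma osc_derivesMd n : derivesMd (osc_l n) (osc_r n).
Proof. by apply: (@swap_first (spaced _));
  rewrite !(inE, mem_cat) ?eqxx ?orbT. Qed.

Lemma derives_rev (S T : identity -> Prop) u v :
  (forall e, S e -> T (rev e.1, rev e.2)) ->
  derives S u v -> derives T (rev u) (rev v).
Proof.
move=> ST; elim=> {u v} [u|u v _|u v w _ uv _|a b s e Se].
- exact: derives_refl.
- exact: derives_sym.
- exact: derives_trans.
have rs w : rev (subst s w) = subst (rev \o s) (rev w).
  elim: w => //= c w IH.
  by rewrite subst_cons rev_cat IH rev_cons -cats1 subst_cat subst_cons cats0.
by rewrite !rev_cat !rs -!catA; apply: (derives_step _ _ _ (ST _ Se)).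
Qed.

Local Notation derivesM := (derives (fun e => e \in basisM)).

(** The mirror image of [swap_second]: the letters of [D] between the last [0] and the last [2] also
    occur in [P ++ Q], so none is simple. *)
Lemma swap_first_M (P Q D : word) : {subset D <= P ++ Q} ->
  derivesM (P ++ [:: 0; 2; 1] ++ Q ++ 0 :: D ++ [:: 2])
           (P ++ [:: 2; 0; 1] ++ Q ++ 0 :: D ++ [:: 2]).
Proof.
move=> DPQ; rewrite -[X in derivesM X]revK -[X in derivesM _ X]revK.
apply: (@derives_rev (fun e => e \in basisMd)) => [_ /mapP[e eM ->]|].
  by rewrite /= !revK -surjective_pairing.
have e x y : rev (P ++ [:: x; y; 1] ++ Q ++ 0 :: D ++ [:: 2]) =
    2 :: rev D ++ 0 :: (rev Q ++ [:: 1]) ++ [:: y, x & rev P].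
  by rewrite !rev_cat rev_cons !rev_cat -cats1 -!catA.
rewrite !e; apply: (@swap_second [::]) => c; rewrite mem_rev => cD _.
have : 0 < count_mem c D by rewrite -has_count has_pred1.
have : 0 < count_mem c (P ++ Q) by rewrite -has_count has_pred1 DPQ.
rewrite count_cat; do 4![rewrite ?count_cat ?count_rev /=].
by move: (count_mem c D) (count_mem c P) (count_mem c Q) => i j k; clear; lia.
Qed.

Lemma osc_derivesM n : derivesM (osc_l n) (osc_r n).
Proof.
apply: swap_first_M => c; rewrite mem_doubles (perm_mem (osc_perm n)).
by rewrite -spaced_cat mem_spaced => /andP[].
Qed.

Definition joint_identity (e : identity) : Prop := derivesN e.1 e.2 /\
  derivesMd e.1 e.2.

(** The joint identities keep the variety inside the join; [b] selects the swaps imposed in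
    addition. *)
Definition osc_system (b : nat -> bool) (e : identity) : Prop :=
  joint_identity e \/ exists2 n, b n & e = (osc_l n, osc_r n).

(** Joint identities fix [osc_l n], which is an isoterm, and swaps with an index other than [n]
    cannot change it. *)
Lemma osc_independent b n u v : b n = false -> derives (osc_system b) u v ->
  u = osc_l n <-> v = osc_l n.
Proof.
move=> bn; elim=> {u v} [//|u v _ IH|u v w _ -> _ -> //|a c r e [[eN eMd]|[m
  bm ->]] /=].
- by symmetry.
- have dN := derives_ctx a c (derives_subst r eN).
  have dMd := derives_ctx a c (derives_subst r eMd).
  have iso := osc_isoterm (osc_uniq n) (osc_perm n) (osc_ge2 n).
  split=> h; apply: iso => //; rewrite -/(osc_l n) -h //; exact: derives_sym.
have nm : n <> m by move=> e'; rewrite -e' bn in bm.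
by split=> h; apply/esym;
  [apply: osc_step_l nm (esym h)|apply: osc_step_r (esym h)].
Qed.

Lemma dual_var (S : identity -> Prop) :
  dual (var S) = var (fun e => S (rev e.1, rev e.2)).
Proof.
apply: mclass_ext => G.
  case=> H SH [f [fbij f1 fM]] e Se a; apply: (bij_inj fbij).
  by rewrite !eval_anti //; apply: (SH _ Se).
move=> SG; exists (opposite G : monoidType); last first.
  by exists (id : G -> opposite G); split=> //; exists id.
move=> [u v] Suv a.
have := SG (rev u, rev v); rewrite /= !revK => /(_ Suv a).
by rewrite /= -!(@eval_anti (opposite G) G id).
Qed.

Lemma dual_varM : dual varM = var (fun e => e \in basisMd).
Proof.
rewrite dual_var; congr var; apply: funext => e; apply: propext.
split=> [eM|/mapP[e' eM ->]]; last by rewrite /= !revK -surjective_pairing.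
by apply/mapP; exists (rev e.1, rev e.2); rewrite //= !revK -surjective_pairing.
Qed.

Lemma sigma2_not_Md : ~ derivesMd sigma2.1 sigma2.2.
Proof.
move=> h; have := @closedbP [:: sigma2.1] basisMd _ _ isT h.
by rewrite !inE eqxx.
Qed.

(** [Phi] is self-dual up to consequences: [sigma3] is its own mirror image after renaming, and
    centrality of squares takes care of $x^2yz\approx xyxzx$. *)
Lemma Phi_Md e : e \in Phi -> derivesMd e.1 e.2.
Proof.
rewrite !inE => /or3P[] /eqP ->.
- exact/derives_sym/(@step_in basisMd [::] [::] [:: 0] [:: 1] [::] [::]
    ([:: 1; 0; 0], [:: 0; 0; 1])).
- apply: (derives_trans [:: 1; 2; 0; 0]).
    exact/derives_sym/(square_front [:: 1; 2] [::] 0).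
  exact: (@step_in basisMd [::] [::] [:: 0] [:: 2] [:: 1] [::]
    ([:: 2; 1; 0; 0], [:: 0; 2; 0; 1; 0])).
exact: (@step_in basisMd [::] [::] [:: 1] [:: 0] [:: 3] [:: 2]
  ([:: 1; 3; 1; 0; 2; 0], [:: 1; 3; 0; 1; 2; 0])).
Qed.

(** * The covering of [N] *)

Local Notation NM := (join varN (dual varM)).

Lemma NM_Phi : subclass NM (var (fun e => e \in Phi)).
Proof.
case: (join_least varN (dual varM)) => _ _; apply; first exact: var_variety.
  by move=> G GN e eP; apply: GN; rewrite mem_cat eP.
rewrite dual_varM => G GM [u v] eP; apply: derives_sound GM _.
exact: (Phi_Md eP).
Qed.

(** A variety [V] in between satisfies [Phi]. If it satisfies [sigma2] as well, it is [N]; if not,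
    [theta_derivesMd] puts the dual of [M] inside it, and it is the whole join. *)
Lemma covers_N : covers NM varN.
Proof.
have [N_NM Md_NM NM_least] := join_least varN (dual varM).
split; [exact: join_variety|exact: var_variety| |].
  split=> // e; apply: sigma2_not_Md; apply: derives_complete => G.
  by rewrite -dual_varM => /Md_NM; rewrite -e => /(_ sigma2 isT).
case=> V [[T eV] [NV nNV] [V_NM nV]].
have [s2|ns2] := pselect (forall G, V G -> satisfies G sigma2).
  apply: nNV; apply: mclass_ext => // G VG e; rewrite mem_cat => /orP[eP|].
    exact: NM_Phi (V_NM _ VG) _ eP.
  by rewrite inE => /eqP ->; apply: s2.
apply: nV; apply: mclass_ext => //; apply: NM_least => //; first by exists T.
rewrite eV dual_varM => G GM [u v] Tuv; apply: derives_sound GM _.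
apply: (@theta_derivesMd (fun u v => forall G, V G -> satisfies G (u, v))).
- by move=> u1 u2 uv H VH a; rewrite (uv H VH a).
- by move=> r u1 u2 uv H VH a; rewrite /= !eval_subst; apply: uv.
- by move=> u1 u2 uv; apply: derives_complete => H NH; apply/uv/NV.
- exact: ns2.
by move=> H; rewrite eV; apply.
Qed.

(** * Varieties given by sets of swaps *)

Definition osc_variety (b : nat -> bool) : mclass := var (osc_system b).

Local Notation NM_interval :=
  (interval (subvarieties NM) (join varM (dual varM)) NM).

Lemma osc_variety_interval b : NM_interval (osc_variety b).
Proof.
have VNM : subclass (osc_variety b) NM.
  move=> G GV W [T ->] NW MW e Te; apply: GV; left; split.
    by apply: derives_complete => H NH; rewrite -surjective_pairing;
      apply: NW Te.
  apply: derives_complete => H MH; rewrite -surjective_pairing; apply: MW Te.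
  by rewrite dual_varM.
split=> //; first by split=> //; apply: var_variety.
case: (join_least varM (dual varM)) => _ _; apply; first exact: var_variety.
  move=> G GM [l r] [[eN _]|[n _ [-> ->]]];
    last exact: derives_sound GM (osc_derivesM n).
  apply: derives_sound eN => e eN; apply: GM; move: eN;
    rewrite !mem_cat => /orP[->//|].
  by rewrite !inE => ->; rewrite !orbT.
rewrite dual_varM => G GM [l r] [[_ eMd]|[n _ [-> ->]]].
  exact: derives_sound eMd.
exact: derives_sound GM (osc_derivesMd n).
Qed.

Lemma osc_variety_sub b c : subclass (osc_variety b) (osc_variety c) ->
  forall n, c n -> b n.
Proof.
move=> bc n cn; apply/negPn/negP => /negbTE bn.
have : derives (osc_system b) (osc_l n) (osc_r n).
  by apply: derives_complete => G /bc; apply; right; exists n.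
by move/(osc_independent bn) => [/(_ erefl)/esym/osc_lr_neq].
Qed.

Lemma osc_variety_mono (b c : nat -> bool) : (forall n, c n -> b n) ->
  subclass (osc_variety b) (osc_variety c).
Proof.
move=> cb G GV e [eNM|[n cn ->]]; apply: GV; first by left.
by right; exists n; rewrite // cb.
Qed.

Lemma osc_variety_inj : injective osc_variety.
Proof.
move=> b c e; apply: funext => n.
by apply/idP/idP; apply: osc_variety_sub; rewrite e => G.
Qed.

(** Identities are countable, so equational theories are coded by binary sequences. *)
Definition theory (V : mclass) (k : nat) : bool :=
  if unpickle k is Some e then `[< forall G, V G -> satisfies G e >] else false.

Definition variety_of (g : nat -> bool) : mclass := var (fun e => g (pickle e)).

Lemma theoryK V : is_variety V -> variety_of (theory V) = V.
Proof.
case=> S ->; apply: mclass_ext => G GV e.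
  by move=> Se; apply: GV; rewrite /theory pickleK; apply/asboolP => H; apply.
by rewrite /theory pickleK => /asboolP; apply.
Qed.

(** Cantor-Bernstein: theories of varieties in the interval form a subset of [nat -> bool], into
    which [theory \o osc_variety] injects all of [nat -> bool]. The resulting bijection is carried
    back to varieties by [variety_of]. *)
Lemma continuum_interval : continuum_many NM_interval.
Proof.
pose A : set (nat -> bool) := fun g => exists2 V, NM_interval V & theory V = g.
have intK b : variety_of (theory (osc_variety b)) = osc_variety b.
  by apply: theoryK; apply: var_variety.
have th_inj : injective (theory \o osc_variety).
  by move=> b c /(congr1 variety_of); rewrite /= !intK => /osc_variety_inj.
have : ([set: nat -> bool] #= A)%card.
  rewrite card_eq_le; apply/andP; split; last exact: subset_card_le.
  rewrite -(card_le_eql (inj_card_eq (in2W th_inj))).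
  apply: subset_card_le => _ [b _ <-]; exists (osc_variety b) => //.
  exact: osc_variety_interval.
case/card_set_bijP => f [fA finj fsurj].
have fK b : NM_interval (variety_of (f b)) /\ theory (variety_of (f b)) = f b.
  have [V IV <-] := fA b I; suff -> : variety_of (theory V) = V by [].
  by apply: theoryK; case: IV => -[].
exists (variety_of \o f); split.
  move=> b c /(congr1 theory); rewrite /= !(fK _).2.
  by apply: finj; rewrite in_setT.
move=> V; split=> [IV|[b <-]]; last exact: (fK b).1.
have [|b _ fb] := fsurj (theory V); first by exists V.
by exists b; rewrite /= fb theoryK //; case: IV => -[].
Qed.

Theorem theorem1p1 :
  covers (join varN (dual varM)) varN /\
  let I := interval (subvarieties (join varN (dual varM)))
             (join varM (dual varM)) (join varN (dual varM)) in
  continuum_many I /\ ~ acc I /\ ~ dcc I.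
Proof.
split; first exact: covers_N.
split; first exact: continuum_interval.
split=> chain.
  (* The set [leq m] of indices from [m] on shrinks as [m] grows, so the varieties strictly
     increase. *)
  have [n] : exists n, forall m, n <= m ->
      osc_variety (leq m) = osc_variety (leq n).
    apply: chain => n; first exact: osc_variety_interval.
    by apply: osc_variety_mono => k; apply: ltnW.
  move/(_ n.+1 (leqnSn n))/osc_variety_inj/(congr1 (@^~ n)).
  by rewrite leqnn ltnn.
(* The set [gtn m] of indices below [m] grows with [m], so the varieties strictly decrease. *)
have [n] : exists n, forall m, n <= m ->
    osc_variety (gtn m) = osc_variety (gtn n).
  apply: chain => n; first exact: osc_variety_interval.
  by apply: osc_variety_mono => k /= kn; apply: ltnW.
move/(_ n.+1 (leqnSn n))/osc_variety_inj/(congr1 (@^~ n)) => /=.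
by rewrite ltnn ltnSn.
Qed.
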